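(* Let $\lambda$ be a partition and let $t$ be a positive real parameter. Then the generating function for volume-weighted pairs of interacting reverse plane partitions of shape $\lambda$ is given, as an identity of formal power series in $q$, by $$\sum_{\Lambda,\Lambda'\in \mathrm{RPP}(\lambda)} q^{|\Lambda|+|\Lambda'|}\,t^{g(\Lambda,\Lambda')}=\prod_{c\in\lambda}\frac{1}{(1-q^{h_\lambda(c)})(1-q^{h_\lambda(c)}t)},$$ where the product is over all cells $c$ of the Young diagram of $\lambda$, $h_\lambda(c)$ is the hook length of $c$, and $g(\Lambda,\Lambda')$ is the number of coupled pairs of lozenges.
   Context: Partitions and RPPs. $\lambda=(\lambda_1\ge\dots\ge\lambda_\ell>0)$ is an integer partition, $\ell=\ell(\lambda)$, $\lambda'$ is the conjugate partition. The cells of $\lambda$ are the pairs $(i,j)$ with $1\le i\le \ell$, $1\le j\le\lambda_i$ ($i$ is the row, numbered from the bottom, $j$ the column). For a cell $c=(i,j)$, the arm of $c$ is the number of cells $(i,j')$ of $\lambda$ with $j'>j$, the leg is the number of cells $(i',j)$ of $\lambda$ with $i'>i$, and $h_\lambda(c)=\mathrm{arm}(c)+\mathrm{leg}(c)+1$. A reverse plane partition (RPP) of shape $\lambda$ is a map $\Lambda$ from the cells of $\lambda$ to the non-negative integers that is weakly increasing in $i$ and weakly increasing in $j$. $\mathrm{RPP}(\lambda)$ is the set of these, and $|\Lambda|$ (the volume) is the sum of the entries. Conventions: $\Lambda(i,0)=\Lambda(0,j)=0$. Coupled pairs. View an RPP as a stack of $\Lambda(i,j)$ unit cubes over each cell $(i,j)$,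 in an infinitely tall room whose back wall follows the boundary of $\lambda$, seen from the corner of small $i,j$; this gives a lozenge tiling. A point $(u,v,h)$ ($u$ in the row direction index $i$, $v$ in the column direction index $j$, $h$ height) is projected to horizontal coordinate $v-u$ and vertical coordinate $h+(u+v)/2$. The picture is cut into vertical slices $[d,d+1]$, $d=-\ell,\dots,\lambda_1-1$. A slice $d$ is a hole slice if $d\in H=\{j-1-\lambda'_j:1\le j\le\lambda_1\}$ and a particle slice if $d\in D=\{\lambda_i-i:1\le i\le \ell\}$ ($H$ and $D$ partition $\{-\ell,\dots,\lambda_1-1\}$). There are three lozenge types: top faces of stacks; ''left'' faces, separating $(i,j-1)$ from $(i,j)$; ''right'' faces, separating $(i-1,j)$ from $(i,j)$. Recording each lozenge, up to a shift depending only on $d$, by the vertical position of the unit vertical segment at horizontal coordinate $d+1$ (the right edge of a left or right face in slice $d$, or the short diagonal of a top face centred at $d+1$), set - for $d\in H$: $O_d(\Lambda)=\{h+i : (i,j)\in\lambda,\ j-i=d+1,\ h\in\mathbb Z,\ \Lambda(i,j-1)<h\le\Lambda(i,j)\}$ (left faces in slice $d$); - for $d\in D$: $B_d(\Lambda)=\{h+i : (i,j)\in\lambda,\ j-i=d,\ h\in\mathbb Z,\ \Lambda(i-1,j)<h\le\Lambda(i,j)\}$ (right faces in slice $d$); - for all $d$: $T_d(\Lambda)=\{\Lambda(i,j)+i+1 : (i,j)\in\lambda,\ j-i=d+1\}$ (top faces). When the tilings of $\Lambda$ (''blue'') and $\Lambda'$ (''red'') are superimposed, a coupled pair is one of: (type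 1) in a hole slice, a blue left face whose right edge is the short diagonal of a red top face; (type 2) in a hole slice, a blue and a red left face in the same position; (type 3) in a particle slice, a blue and a red right face in the same position; (type 4) in a particle slice, a red right face whose right edge is the short diagonal of a blue top face. Then $g(\Lambda,\Lambda')$ is the number of coupled pairs, i.e. $$g(\Lambda,\Lambda')=\sum_{d\in H}\big(|O_d(\Lambda)\cap T_d(\Lambda')|+|O_d(\Lambda)\cap O_d(\Lambda')|\big)+\sum_{d\in D}\big(|B_d(\Lambda)\cap B_d(\Lambda')|+|T_d(\Lambda)\cap B_d(\Lambda')|\big).$$ *)

(* Defs.v *)
From HB Require Import structures.
From mathcomp Require Import all_boot all_order all_algebra finmap.
From mathcomp Require Import boolp classical_sets cardinality fsbigop reals.

Set Implicit Arguments.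
Unset Strict Implicit.
Unset Printing Implicit Defensive.

Import Order.TTheory GRing.Theory Num.Theory.

Local Open Scope ring_scope.

Record fps (R : Type) := FPS { fps_coef : nat -> R }.

Lemma fpsP (R : Type) (f g : fps R) : fps_coef f =1 fps_coef g -> f = g.
Proof. by case: f g => [f] [g] /= /funext ->. Qed.

HB.instance Definition _ (R : Type) := gen_eqMixin (fps R).
HB.instance Definition _ (R : Type) := gen_choiceMixin (fps R).

Section FpsZmodule.
Variable R : zmodType.
Implicit Types f g h : fps R.

Definition fps_zero : fps R := FPS (fun=> 0).
Definition fps_opp f : fps R := FPS (fun n => - fps_coef f n).
Definition fps_add f g : fps R := FPS (fun n => fps_coef f n + fps_coef g n).

Lemma fps_addA : associative fps_add.
Proof. by move=> f g h; apply: fpsP => n /=; rewrite addrA. Qed.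
Lemma fps_addC : commutative fps_add.
Proof. by move=> f g; apply: fpsP => n /=; rewrite addrC. Qed.
Lemma fps_add0 : left_id fps_zero fps_add.
Proof. by move=> f; apply: fpsP => n /=; rewrite add0r. Qed.
Lemma fps_addN : left_inverse fps_zero fps_opp fps_add.
Proof. by move=> f; apply: fpsP => n /=; rewrite addNr. Qed.

HB.instance Definition _ :=
  GRing.isZmodule.Build (fps R) fps_addA fps_addC fps_add0 fps_addN.
End FpsZmodule.

Section FpsRing.
Variable R : fieldType.
Implicit Types f g h : fps R.

Definition fpsC (a : R) : fps R := FPS (fun n => if n == 0%N then a else 0).
Definition fpsX : fps R := FPS (fun n => (n == 1%N)%:R).

Definition fps_mul f g : fps R :=
  FPS (fun n => \sum_(k < n.+1) fps_coef f k * fps_coef g (n - k)).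

Definition fps_trunc (m : nat) f : {poly R} := \poly_(i < m.+1) fps_coef f i.

Lemma coef_fps_trunc m f n : (n <= m)%N -> (fps_trunc m f)`_n = fps_coef f n.
Proof. by move=> le_nm; rewrite coef_poly ltnS le_nm. Qed.

Lemma coef_fps_mul m f g n : (n <= m)%N ->
  fps_coef (fps_mul f g) n = (fps_trunc m f * fps_trunc m g)`_n.
Proof.
move=> le_nm; rewrite coefM /=; apply: eq_bigr => k _; have le_kn := leq_ord k.
by rewrite !coef_fps_trunc // (leq_trans _ le_nm) // leq_subr.
Qed.

Lemma fps_mulC : commutative fps_mul.
Proof.
by move=> f g; apply: fpsP => n; rewrite !(coef_fps_mul _ _ (leqnn n)) mulrC.
Qed.

Lemma fps_mulA : associative fps_mul.
Proof.
move=> f g h; apply: fpsP => n.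
transitivity ((fps_trunc n f * (fps_trunc n g * fps_trunc n h))`_n).
  rewrite coefM; apply: eq_bigr => k _; have le_kn := leq_ord k.
  by rewrite coef_fps_trunc // (@coef_fps_mul n) // leq_subr.
rewrite mulrA coefM; apply: eq_bigr => k _; have le_kn := leq_ord k.
by rewrite (@coef_fps_mul n) // coef_fps_trunc // leq_subr.
Qed.

Lemma fps_mul1 : left_id (fpsC 1) fps_mul.
Proof.
move=> f; apply: fpsP => n /=; rewrite big_ord_recl /= mul1r subn0.
by rewrite big1 ?addr0 // => k _; rewrite mul0r.
Qed.

Lemma fps_mulDl : left_distributive fps_mul (@fps_add R).
Proof.
move=> f g h; apply: fpsP => n /=; rewrite -big_split /=.
by apply: eq_bigr => k _; rewrite mulrDl.
Qed.

Lemma fps_1_neq0 : fpsC 1 != 0 :> fps R.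
Proof.
apply/eqP => /(congr1 (fun f => fps_coef f 0)) /= /eqP.
by rewrite oner_eq0.
Qed.

HB.instance Definition _ := GRing.Zmodule_isComNzRing.Build (fps R)
  fps_mulA fps_mulC fps_mul1 fps_mulDl fps_1_neq0.

(* The first n coefficients g_0, ..., g_(n-1) of 1/f, from the recurrence
   f_0 g_n = [n = 0] - (f_1 g_(n-1) + ... + f_n g_0). *)
Fixpoint fps_inv_coefs f (n : nat) : seq R :=
  if n is m.+1 then
    let s := fps_inv_coefs f m in
    rcons s ((fps_coef f 0)^-1 *
      ((m == 0%N)%:R - \sum_(k < m) fps_coef f k.+1 * s`_(m - k.+1)))
  else [::].

Definition fps_unit : {pred fps R} := fun f => fps_coef f 0 != 0.

Definition fps_inv f : fps R :=
  if fps_coef f 0 == 0 then f else FPS (fun n => (fps_inv_coefs f n.+1)`_n).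

Lemma size_fps_inv_coefs f n : size (fps_inv_coefs f n) = n.
Proof. by elim: n => //= n IHn; rewrite size_rcons IHn. Qed.

Lemma nth_fps_inv_coefs f n k : (k < n)%N ->
  (fps_inv_coefs f n)`_k = (fps_inv_coefs f k.+1)`_k.
Proof.
elim: n => // n IHn; rewrite ltnS leq_eqVlt => /predU1P[-> //|lt_kn].
by rewrite [fps_inv_coefs f n.+1]/= nth_rcons size_fps_inv_coefs lt_kn IHn.
Qed.

Lemma fps_mulVf : {in fps_unit, left_inverse 1 fps_inv *%R}.
Proof.
move=> f; rewrite unfold_in => f0; rewrite mulrC; apply: fpsP => n.
have invE m : fps_coef (fps_inv f) m = (fps_inv_coefs f m.+1)`_m.
  by rewrite /fps_inv (negPf f0).
transitivity (fps_coef f 0 * fps_coef (fps_inv f) n +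
    \sum_(k < n) fps_coef f k.+1 * fps_coef (fps_inv f) (n - k.+1)).
  by rewrite /= big_ord_recl subn0.
rewrite invE [fps_inv_coefs f n.+1]/= nth_rcons size_fps_inv_coefs ltnn eqxx.
rewrite mulVKf // -addrA [X in _ + X]addrC.
under [X in X - _]eq_bigr => k _.
  rewrite invE -(@nth_fps_inv_coefs _ n) ?ltn_subrL ?(leq_trans _ (ltn_ord k)) //.
  over.
by rewrite subrr addr0; case: n.
Qed.

Lemma fps_unitPl f g : g * f = 1 -> fps_unit f.
Proof.
move=> /(congr1 (fun h => fps_coef h 0)) /=.
rewrite big_ord1 /fps_unit => /eqP; apply: contraTneq => ->.
by rewrite mulr0 eq_sym oner_eq0.
Qed.

Lemma fps_inv_out : {in [predC fps_unit], fps_inv =1 id}.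
Proof. by move=> f; rewrite inE /= unfold_in negbK /fps_inv => ->. Qed.

HB.instance Definition _ := GRing.ComNzRing_hasMulInverse.Build (fps R)
  fps_mulVf fps_unitPl fps_inv_out.

(* Sum of a family of series over a possibly infinite index set: each
   coefficient is a finitely supported sum.  It is meaningful when, for every
   n, only finitely many members of the family have a nonzero coefficient of
   degree n (see rpp_pairs_summable below). *)
Definition fps_sum (I : choiceType) (A : set I) (F : I -> fps R) : fps R :=
  FPS (fun n => \sum_(x \in A) fps_coef (F x) n).

Lemma coef_fpsXn m n : fps_coef (fpsX ^+ m) n = (n == m)%:R.
Proof.
elim: m n => [|m IHm] n; first by case: n.
rewrite exprS; case: n => [|n] /=; first by rewrite big_ord1 mul0r.
rewrite big_ord_recl mul0r add0r big_ord_recl mul1r /= subSS subn0 IHm.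
by rewrite big1 ?addr0 // => k _; rewrite mul0r.
Qed.

Lemma coef_fpsXnC m a n : fps_coef (fpsX ^+ m * fpsC a) n = if n == m then a else 0.
Proof.
rewrite /= big_ord_recr /= subnn eqxx coef_fpsXn big1 => [|k _].
  by rewrite add0r; case: eqP; rewrite ?mul1r ?mul0r.
by rewrite subn_eq0 leqNgt ltn_ord mulr0.
Qed.
End FpsRing.

Definition is_partition (la : seq nat) : bool := sorted geq la && (0%N \notin la).

(* Rows and columns are numbered from 1. *)
Definition part (la : seq nat) (i : nat) : nat := nth 0%N la i.-1.
Definition conj_part (la : seq nat) (j : nat) : nat := count (fun x => j <= x)%N la.

Definition cells (la : seq nat) : seq (nat * nat) :=
  [seq (i, j) | i <- iota 1 (size la), j <- iota 1 (part la i)].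

Definition cell (la : seq nat) : finType := seq_sub (cells la).

Definition arm (la : seq nat) (c : nat * nat) : nat :=
  count (fun c' => (c'.1 == c.1) && (c.2 < c'.2)%N) (cells la).
Definition leg (la : seq nat) (c : nat * nat) : nat :=
  count (fun c' => (c'.2 == c.2) && (c.1 < c'.1)%N) (cells la).
Definition hook (la : seq nat) (c : nat * nat) : nat := (arm la c + leg la c + 1)%N.

Definition filling (la : seq nat) : choiceType := {ffun cell la -> nat}.

Definition RPP (la : seq nat) : set (filling la) :=
  [set L | forall c c' : cell la,
     ((val c).1 = (val c').1 /\ ((val c).2 <= (val c').2)%N) \/
     ((val c).2 = (val c').2 /\ ((val c).1 <= (val c').1)%N) ->
     (L c <= L c')%N]%classic.
Arguments RPP : clear implicits.

Definition volume (la : seq nat) (L : filling la) : nat := (\sum_(c : cell la) L c)%N.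

(* The entry at (i, j), extended by 0 outside the diagram; in particular
   entry L i 0 = entry L 0 j = 0. *)
Definition entry (la : seq nat) (L : filling la) (i j : nat) : nat :=
  if insub (i, j) is Some c then L c else 0%N.

Definition hole_slices (la : seq nat) : {fset int} :=
  [fset d in [seq j%:Z - 1 - (conj_part la j)%:Z | j <- iota 1 (part la 1)]]%fset.
Definition particle_slices (la : seq nat) : {fset int} :=
  [fset d in [seq (part la i)%:Z - i%:Z | i <- iota 1 (size la)]]%fset.

Definition diagonal (la : seq nat) (e : int) : seq (nat * nat) :=
  [seq c <- cells la | c.2%:Z - c.1%:Z == e].

(* The height h of a left or right face exceeds an entry, hence is positive,
   so all recorded positions are natural numbers; h ranges over a < h <= b. *)
Definition left_faces (la : seq nat) (L : filling la) (d : int) : {fset nat} :=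
  [fset x in [seq (h + c.1)%N | c <- diagonal la (d + 1),
     h <- index_iota (entry L c.1 c.2.-1).+1 (entry L c.1 c.2).+1]]%fset.
Definition right_faces (la : seq nat) (L : filling la) (d : int) : {fset nat} :=
  [fset x in [seq (h + c.1)%N | c <- diagonal la d,
     h <- index_iota (entry L c.1.-1 c.2).+1 (entry L c.1 c.2).+1]]%fset.
Definition top_faces (la : seq nat) (L : filling la) (d : int) : {fset nat} :=
  [fset x in [seq (entry L c.1 c.2 + c.1 + 1)%N | c <- diagonal la (d + 1)]]%fset.

Definition coupled_pairs (la : seq nat) (L L' : filling la) : nat :=
  (\sum_(d <- hole_slices la)
     (#|` left_faces L d `&` top_faces L' d|
      + #|` left_faces L d `&` left_faces L' d|)
   + \sum_(d <- particle_slices la)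
     (#|` right_faces L d `&` right_faces L' d|
      + #|` top_faces L d `&` right_faces L' d|))%N%fset.

Lemma rpp_pairs_summable (R : fieldType) (la : seq nat) (t : R) (n : nat) :
  finite_set [set p : filling la * filling la |
    fps_coef (fpsX R ^+ (volume p.1 + volume p.2)
              * fpsC (t ^+ coupled_pairs p.1 p.2)) n != 0]%classic.
Proof.
pose F : {ffun cell la -> 'I_n.+1} * {ffun cell la -> 'I_n.+1}
    -> filling la * filling la :=
  fun p => ([ffun c => p.1 c : nat], [ffun c => p.2 c : nat]).
apply: (@sub_finite_set _ _ (F @` setT)%classic); last exact/finite_image/finite_finset.
move=> [L L']; rewrite /mkset coef_fpsXnC /=.
case: (n =P _) => [nE _|_]; last by rewrite eqxx.
have le1 c : (L c < n.+1)%N.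
  by rewrite ltnS nE /volume (bigD1 c) //= -!addnA leq_addr.
have le2 c : (L' c < n.+1)%N.
  by rewrite ltnS nE addnC /volume (bigD1 c) //= -!addnA leq_addr.
exists ([ffun c => Ordinal (le1 c)], [ffun c => Ordinal (le2 c)]) => //.
by congr pair; apply/ffunP => c; rewrite !ffunE.
Qed.

(* Main.v *)
Require Import Defs.
From mathcomp Require Import all_boot all_order all_algebra finmap.
From mathcomp Require Import zify ring lra.
From mathcomp Require Import boolp classical_sets functions cardinality fsbigop.
From mathcomp Require Import reals ereal topology normedtype sequences esum.

(** The diagonals of an RPP, read from left to right, form a path of
    interlacing particle configurations, one step per slice: a hole step keeps
    the number of particles and a particle step removes one.  The coupled
    pairs are counted slice by slice, so the generating function is a path sum
    of two-coloured transfer kernels, where hole step k carries the parameter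
    x_k = q^-k and particle step k the parameter y_k = q^k.

    The kernels satisfy a Cauchy identity: exchanging a hole step followed by
    a particle step costs the factor 1 / ((1 - xy)(1 - xyt)).  It is proved by
    scanning the positions from the bottom; the partial sums of the two
    orders, indexed by which particles are still to be placed, are related by
    a constant triangular matrix (a Yang-Baxter intertwiner).  Sorting the
    word of slices gives one factor per pair (hole before particle), i.e. per
    cell, with xy = q^hook.  All sums are taken in [0, +oo] for small real
    q > 0, and the identity theorem for power series returns to coefficients. *)

Set Implicit Arguments.
Unset Strict Implicit.
Unset Printing Implicit Defensive.
Import Order.TTheory GRing.Theory Num.Theory.
Import numFieldNormedType.Exports.

(** * Particle configurations *)

(** The two sides of the Cauchy identity cannot be compared term by term: in the order hole-particle
    the middle configuration has as many particles as the left one, in the opposite order one fewer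
    in each colour. They become comparable as entries of state vectors. The hole-particle sum is the
    entry where nothing is left unmatched; there the intertwiner is the identity, so it equals the
    same entry of the particle-hole system, whose own sum is the entry where everything is
    unmatched. Above all particles of the outer configurations these two entries are linked by an
    affine recursion, since each colour may still place one extra particle arbitrarily high: with z
    = xy, a position costs z once one colour is placed and (zt)^2 once both are. The fixed point of
    this recursion supplies 1 / ((1 - z)(1 - zt)). In the sorted word the particle steps act on
    packed configurations 1, ..., k, where the step is forced and has weight 1, and the hole steps
    act on the empty one, so only the exchange factors remain. *)

Definition cnt (S : seq nat) (p : nat) : nat := count (fun i => i <= p) S.
(* [A] is the old and [n] the new configuration of one step; the [i]-th
   particle of [n] sits between the [i]-th and the [i+1]-st of [A].  [pending]
   means that at [p] one particle of [A] is not yet matched, and [pending_in]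
   says the same just before a particle of [n] may be placed at [p]. *)
Definition pending (A n : seq nat) (p : nat) : bool := cnt n p < cnt A p.
Definition pending_in (A n : seq nat) (p : nat) : bool := cnt n p.-1 < cnt A p.
Definition config (S : seq nat) : bool := path ltn 0 S.

Lemma config_sorted S : config S -> sorted ltn S.
Proof. exact: path_sorted. Qed.

Lemma config_uniq S : config S -> uniq S.
Proof. by move/config_sorted; apply: sorted_uniq => [|i]; [exact: ltn_trans|exact: ltnn]. Qed.

Lemma config_gt0 S : config S -> all (ltn 0) S.
Proof. by apply: order_path_min; exact: ltn_trans. Qed.

Lemma config0 S : config S -> 0 \notin S.
Proof. by move=> /config_gt0/allP S0; apply/negP => /S0. Qed.

Lemma config_rcons S i : config (rcons S i) = config S && (last 0 S < i).
Proof. by rewrite /config rcons_path. Qed.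

Lemma config_last S : config S -> {in S, forall i, i <= last 0 S}.
Proof.
elim/last_ind: S => // S i IH; rewrite config_rcons last_rcons => /andP[cS Si] j.
by rewrite mem_rcons inE => /predU1P[->//|/(IH cS)]; lia.
Qed.

Lemma cntS S p : uniq S -> cnt S p.+1 = cnt S p + (p.+1 \in S).
Proof.
elim: S => //= i S IH /andP[iS /IH]; rewrite /cnt /= inE => ->.
case: (p.+1 =P i) => [e|ne] /=; last by lia.
by rewrite -e in iS *; rewrite ltnn (negPf iS) leqnn add0n addn0 addnC.
Qed.

Lemma leq_cnt S p q : p <= q -> cnt S p <= cnt S q.
Proof. by move=> pq; apply: sub_count => i /=; lia. Qed.

Lemma cnt_size S p : cnt S p <= size S. Proof. exact: count_size. Qed.

Lemma cnt_full S p : config S -> last 0 S <= p -> cnt S p = size S.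
Proof.
move=> cS Sp; apply/eqP; rewrite -all_count; apply/allP => i /(config_last cS); lia.
Qed.

Lemma cnt0 S : config S -> cnt S 0 = 0.
Proof.
move=> /config_gt0/allP S0; apply/eqP; rewrite -leqn0 leqNgt -has_count.
by apply/hasPn => i /S0 /=; lia.
Qed.

Fixpoint cfgs (N : nat) : seq (seq nat) :=
  if N is M.+1 then cfgs M ++ [seq rcons s M.+1 | s <- cfgs M] else [:: [::]].

Lemma mem_cfgs N s : (s \in cfgs N) = config s && (last 0 s <= N).
Proof.
elim: N s => [|N IH] s.
  rewrite inE; elim/last_ind: s => // s i _; rewrite config_rcons last_rcons.
  by case: eqP => [|_]; [case: s|lia].
rewrite mem_cat IH; apply/idP/idP => [/orP[/andP[->]|/mapP[s']]|/andP[cs]]; first by lia.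
  by rewrite IH => /andP[cs ls] ->; rewrite config_rcons last_rcons cs; lia.
elim/last_ind: s cs => [|s i _]; first by rewrite /config.
rewrite config_rcons last_rcons => /andP[cs si] iN; rewrite cs si /=.
have [//|/= Ni] := leqP i N; have -> : i = N.+1 by lia.
by apply/mapP; exists s => //; rewrite IH cs; lia.
Qed.

Lemma cfgs_uniq N : uniq (cfgs N).
Proof.
elim: N => //= N IH; rewrite cat_uniq IH map_inj_uniq ?IH ?andbT /=.
  apply/hasPn => s /mapP[s']; rewrite !mem_cfgs => _ ->; rewrite last_rcons.
  by rewrite ltnn andbF.
by move=> s s' /rcons_inj[].
Qed.

Definition config2 := (seq nat * seq nat)%type.

(* Transition of one colour at one position: [a] and [b] tell whether the left
   configuration [A] and the (shifted) right configuration [B] have a particle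
   there, [n] whether the middle one does; [(u, v)] is the state afterwards. *)
Definition bits_ok (u v n a b : bool) : bool :=
  [&& ~~ (n && (u || v)), a ==> (u || n) & b ==> (v || n)].

(** The inequalities of [ilace A n] at [p] together with those of [ilace n B], the lower one taken
    at [p - 1]. Reading [B] one position late makes [A] and [B] play the same role: a particle of
    [n] at [p] may already match one of [A] at [p] or one of [B] at [p - 1]. *)
Definition ok_at (A B n : seq nat) (p : nat) : bool :=
  [&& cnt n p <= cnt A p, cnt A p <= (cnt n p.-1).+1,
      cnt n p <= (cnt B p.-1).+1 & cnt B p.-1 <= cnt n p.-1].

Definition ok_state (A B n : seq nat) (N : nat) : bool :=
  [&& cnt n N <= cnt A N, cnt A N <= (cnt n N).+1,
      cnt n N <= (cnt B N.-1).+1 & cnt B N.-1 <= cnt n N].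

Lemma ok_at_state A B n p : ok_at A B n p -> ok_state A B n p.
Proof. by rewrite /ok_at /ok_state; have := @leq_cnt n p.-1 p (leq_pred p); lia. Qed.

Definition ok_upto A B n N := all (ok_at A B n) (iota 1 N).

Lemma ok_uptoS A B n N : ok_upto A B n N.+1 = ok_upto A B n N && ok_at A B n N.+1.
Proof. by rewrite /ok_upto -[in LHS](addn1 N) iotaD all_cat add1n /= andbT. Qed.

Lemma ok_upto_state A B n N : config A -> config B -> config n ->
  ok_upto A B n N -> ok_state A B n N.
Proof.
move=> cA cB cn; case: N => [_|N]; first by rewrite /ok_state /= !cnt0.
by rewrite ok_uptoS => /andP[_ /ok_at_state].
Qed.

Lemma ok_state_bool A B n N : ok_state A B n N ->
  (exists e : bool, cnt A N = cnt n N + e) /\ (exists e : bool, cnt n N = cnt B N.-1 + e).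
Proof.
move=> /and4P[nA An nB Bn].
by split; [exists (cnt n N < cnt A N)|exists (cnt B N.-1 < cnt n N)]; lia.
Qed.

Section Color.
Variables (A B n : seq nat) (N : nat) (u v : bool).
Let a := N.+1 \in A. Let b := N \in B. Let i := N.+1 \in n.
Hypotheses (cA : config A) (cB : config B) (cn : config n).
Hypothesis (Inv : ok_state A B n N).

Let cA1 : cnt A N.+1 = cnt A N + a. Proof. exact/cntS/config_uniq. Qed.
Let cn1 : cnt n N.+1 = cnt n N + i. Proof. exact/cntS/config_uniq. Qed.
Let cB1 : cnt B N = cnt B N.-1 + b.
Proof.
rewrite /b; case: N => [|M] /=; first by rewrite (negPf (config0 cB)) addn0.
exact/cntS/config_uniq.
Qed.

(** By [ok_state] the counts of [A], [n] and [B] differ by bits; once the common value [cnt B N.-1]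
    is cancelled by induction, the equivalence is a check on finitely many bits. *)
Lemma ok_at_step :
  [&& ok_at A B n N.+1, pending A n N.+1 == u & ~~ pending_in n B N.+1 == v] =
  [&& bits_ok u v i a b, pending A n N == (u || i) && ~~ a & ~~ pending_in n B N == (v || i) && ~~ b].
Proof.
rewrite /ok_at /pending /pending_in /bits_ok /= cA1 cn1 cB1.
have [[e1 ->] [e2 ->]] := ok_state_bool Inv.
elim: (cnt B N.-1) => [|c IH]; last by rewrite !addSn !ltnS.
by case: a b i u v e1 e2 => [] [] [] [] [] [] [].
Qed.

Lemma pending_in_step : ok_at A B n N.+1 -> pending_in A n N.+1 = pending A n N.+1 || i.
Proof.
rewrite /ok_at /pending /pending_in /= cA1 cn1 cB1.
have [[e1 ->] [e2 ->]] := ok_state_bool Inv.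
elim: (cnt B N.-1) => [|c IH]; last by rewrite !addSn !ltnS.
by case: a b i e1 e2 => [] [] [] [] [].
Qed.

Lemma pending_step : ok_at A B n N.+1 -> ~~ pending n B N = ~~ pending_in n B N.+1 || i.
Proof.
rewrite /ok_at /pending /pending_in /= cA1 cn1 cB1.
have [[e1 ->] [e2 ->]] := ok_state_bool Inv.
elim: (cnt B N.-1) => [|c IH]; last by rewrite !addSn !ltnS.
by case: a b i e1 e2 => [] [] [] [] [].
Qed.
End Color.

(** Interlacing through counting functions: one formula covers both kinds of step (equal sizes, or
    one particle fewer), and it can be tested position by position. The [p.-1] makes the next
    particle of [A] lie strictly above the preceding one of [n]. *)
Definition ilace (A n : seq nat) : bool :=
  `[< forall p, cnt n p <= cnt A p <= (cnt n p.-1).+1 >].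

(* In steps, [b = true] stands for a hole slice and [b = false] for a particle
   slice; position [p] here is position [p + 1] of the face sets. *)
Definition vol_at (b : bool) (A n : seq nat) (p : nat) : bool :=
  if b then pending A n p else ~~ pending_in A n p.
Definition coupled_at (b : bool) (a n : config2) (p : nat) : bool :=
  if b then pending a.1 n.1 p && pending_in a.2 n.2 p else ~~ pending a.1 n.1 p && ~~ pending_in a.2 n.2 p.
(** The upper end is merely past all particles: for the sizes of a slice step the summand vanishes
    from there on, so the end can be moved at will. *)
Definition vol_exp (b : bool) (A n : seq nat) : nat :=
  \sum_(1 <= p < (last 0 A + last 0 n).+1) vol_at b A n p.
Definition coupled_exp (b : bool) (a n : config2) : nat :=
  \sum_(1 <= p < (last 0 a.1 + last 0 n.1 + (last 0 a.2 + last 0 n.2)).+1) coupled_at b a n p.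

Lemma sum_nat_vanish (g : nat -> nat) m M N : m <= M -> M <= N ->
  (forall p, M <= p -> g p = 0) -> \sum_(m <= p < N) g p = \sum_(m <= p < M) g p.
Proof.
move=> mM MN g0; rewrite (big_cat_nat mM MN) /= [X in _ + X]big_nat_cond.
by rewrite [X in _ + X]big1 ?addn0 // => p /andP[/andP[/g0]].
Qed.

Lemma sum_nat_vanish2 (g : nat -> nat) m M N : m <= M -> m <= N ->
  (forall p, M <= p -> g p = 0) -> (forall p, N <= p -> g p = 0) ->
  \sum_(m <= p < M) g p = \sum_(m <= p < N) g p.
Proof.
move=> mM mN gM gN; have [MN|/ltnW NM] := leqP M N; last exact: sum_nat_vanish.
by apply: esym; exact: sum_nat_vanish.
Qed.

Lemma sum_nat_predn (g : nat -> nat) N : 0 < N ->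
  \sum_(1 <= p < N.+1) g p.-1 = g 0 + \sum_(1 <= p < N) g p.
Proof.
by case: N => // N _; rewrite big_add1 /= big_nat_recl //= [in RHS]big_add1.
Qed.

Lemma pending_full b A n p : config A -> config n -> size A = size n + ~~ b ->
  last 0 A <= p -> last 0 n <= p -> pending A n p = ~~ b.
Proof. by move=> cA cn s lA ln; rewrite /pending !cnt_full // s; case: b {s} => /=; lia. Qed.

Lemma pending_in_full b A n p : config A -> config n -> size A = size n + ~~ b ->
  last 0 A <= p -> last 0 n < p -> pending_in A n p = ~~ b.
Proof. by move=> cA cn s lA ln; rewrite /pending_in !cnt_full ?s; case: b {s} => //=; lia. Qed.

Lemma vol_expE b A n N : config A -> config n -> size A = size n + ~~ b ->
  last 0 A <= N -> last 0 n <= N -> vol_exp b A n = \sum_(1 <= p < N.+1) vol_at b A n p.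
Proof.
move=> cA cn s lA ln; apply: sum_nat_vanish2 => // p pN; rewrite /vol_at; case: b s => s.
- by rewrite (pending_full cA cn s) //; lia.
- by rewrite (pending_in_full cA cn s) //; lia.
- by rewrite (pending_full cA cn s) //; lia.
- by rewrite (pending_in_full cA cn s) //; lia.
Qed.

Lemma vol_exp_holeE A n N : config A -> config n -> size A = size n -> 0 < N ->
  last 0 A <= N -> last 0 n <= N -> vol_exp true A n = \sum_(1 <= p < N) pending A n p.
Proof.
move=> cA cn; move=> s N0 lA ln; have s' : size A = size n + ~~ true by rewrite addn0.
rewrite (@vol_expE true A n N) //; apply: sum_nat_vanish => // p pN.
by rewrite /vol_at (pending_full cA cn s') //; lia.
Qed.

Lemma coupled_expE b a n N : config a.1 -> config n.1 -> size a.1 = size n.1 + ~~ b ->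
  last 0 a.1 <= N -> last 0 n.1 <= N -> last 0 a.2 <= N -> last 0 n.2 <= N -> 0 < N ->
  coupled_exp b a n = \sum_(1 <= p < N) coupled_at b a n p.
Proof.
move=> cA cn s lA ln lA2 ln2 N0; apply: sum_nat_vanish2 => // p pN.
  by rewrite /coupled_at (pending_full cA cn s); [case: b s|lia|lia].
by rewrite /coupled_at (pending_full cA cn s); [case: b s|lia|lia].
Qed.

Section Color.
Variables (A B n : seq nat) (N : nat).
Hypotheses (cA : config A) (cB : config B) (cn : config n).
Hypotheses (lA : last 0 A <= N) (lB : last 0 B < N) (ln : last 0 n <= N).

Let N0 : 0 < N. Proof. by case: N lB. Qed.
Let fA p : N <= p -> cnt A p = size A. Proof. by move=> Np; apply: cnt_full => //; lia. Qed.
Let fB p : N.-1 <= p -> cnt B p = size B. Proof. by move=> Np; apply: cnt_full => //; lia. Qed.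
Let fn p : N <= p -> cnt n p = size n. Proof. by move=> Np; apply: cnt_full => //; lia. Qed.

Lemma ok_uptoP : reflect (forall p, 0 < p -> p <= N -> ok_at A B n p) (ok_upto A B n N).
Proof.
apply: (iffP allP) => H p; last by rewrite mem_iota add1n ltnS => /andP[]; exact: H.
by move=> p0 pN; apply: H; rewrite mem_iota add1n ltnS p0.
Qed.

(** Beyond [N] all counts are constant, so a finite scan decides both interlacings. The final state
    records the sizes: [e = false] is the order hole-particle, [e = true] the opposite one. *)
Lemma ok_upto_ilace (e : bool) :
  [&& ok_upto A B n N, pending A n N == e & ~~ pending_in n B N == e] =
  [&& ilace A n, ilace n B, size A == size n + e & size n == size B + ~~ e].
Proof.
have [fAN fBN fnN] : [/\ cnt A N = size A, cnt B N = size B & cnt n N = size n].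
  by rewrite fA // fB // ?fn //; lia.
have fBN' : cnt B N.-1 = size B by apply: fB.
have nN : cnt n N.-1 <= size n by apply: cnt_size.
apply/and3P/and4P => [[/ok_uptoP ok]|[/asboolP ilA /asboolP ilB /eqP sA /eqP sn]].
  have := ok N N0 (leqnn N); rewrite /ok_at /pending /pending_in fAN fBN' fnN => /and4P[k1 k2 k3 k4] /eqP e1 /eqP e2.
  have sA : size A = size n + e by case: e e1 {e2} => /=; lia.
  have sn : size n = size B + ~~ e by case: e e2 {e1 sA} => /=; lia.
  split; try exact/eqP.
    apply/asboolP => p; have [pN|pN] := leqP p N.
      by case: p pN => [|p] pN; [rewrite !cnt0|have /and4P[-> ->] := ok p.+1 isT pN].
    have [-> -> ->] : [/\ cnt A p = size A, cnt n p = size n & cnt n p.-1 = size n].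
      by split; [apply: fA|apply: fn|apply: fn]; lia.
    by rewrite sA; case: (e) => /=; lia.
  apply/asboolP => p; have [pN|pN] := ltnP p N.
    have /and4P[_ _ _ ->] := ok p.+1 isT pN.
    case: p pN => [|p] pN; [by rewrite !cnt0|].
    by have /and4P[_ _ -> _] := ok p.+1 isT (ltnW pN).
  have [-> -> ->] : [/\ cnt B p = size B, cnt B p.-1 = size B & cnt n p = size n].
    by split; [apply: fB|apply: fB|apply: fn]; lia.
  by rewrite sn; case: (e) => /=; lia.
split.
- apply/ok_uptoP => p p0 pN; rewrite /ok_at.
  have /andP[-> ->] := ilA p; have /andP[_ ->] := ilB p; by have /andP[-> _] := ilB p.-1.
- by rewrite /pending fAN fnN sA; case: e {sA sn} => /=; lia.
- by rewrite /pending_in fBN' fnN sn; case: e {sA sn} => /=; lia.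
Qed.
End Color.

Lemma cnt_iota k p : cnt (iota 1 k) p = minn p k.
Proof.
elim: k => [|k IH]; first by rewrite minn0.
by rewrite -[in iota _ _](addn1 k) iotaD /cnt count_cat -/(cnt _ _) IH /=; lia.
Qed.

Lemma config_iota k : config (iota 1 k).
Proof. by rewrite /config; case: k => // k; apply: (iota_ltn_sorted 0 k.+2). Qed.

(** On a packed configuration the upper bound of [ilace] leaves no freedom: by induction
    [cnt n p = p] for [p <= k]. *)
Lemma ilace_iotaP k n : config n -> size n = k ->
  ilace (iota 1 k.+1) n = (n == iota 1 k).
Proof.
move=> cn sn; apply/asboolP/eqP => [il|->]; last by move=> p; rewrite !cnt_iota; lia.
have cntp p : p <= k -> cnt n p = p.
  elim: p => [|p IH] pk; first by rewrite cnt0.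
  have /andP[_] := il p.+2; rewrite cnt_iota /= cntS ?config_uniq // IH ?(ltnW pk) //.
  by case: (_ \in n); lia.
apply: (irr_sorted_eq ltn_trans ltnn (config_sorted cn) (iota_ltn_sorted _ _)).
have sub : {subset iota 1 k <= n}.
  case=> [|p]; rewrite mem_iota add1n ltnS //= => pk.
  have := cntp p.+1 pk; rewrite cntS ?config_uniq // cntp; last exact: ltnW.
  by case: (_ \in n) => //; lia.
by have [_ e] := uniq_min_size (iota_uniq 1 k) sub (eq_leq (etrans sn (esym (size_iota 1 k)))).
Qed.

(** * Slices, cells and hooks of a partition *)

(** Turns a bound on values into a bound on indices; used for conjugate parts, lengths of diagonals
    and particle positions ([part_conj], [leq_diag_rows], [nth_cnt]). *)
Lemma prefix_count (T : Type) (P : pred T) x0 (s : seq T) i :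
  (forall j k, j <= k < size s -> P (nth x0 s k) -> P (nth x0 s j)) ->
  i < size s -> P (nth x0 s i) = (i < count P s).
Proof.
elim: s i => // x s IH i H /=; have [Px|nPx] := boolP (P x).
  case: i => [|i] //= si; rewrite add1n ltnS IH // => j k jk.
  exact: (H j.+1 k.+1).
have nP k : k < (size s).+1 -> P (nth x0 (x :: s) k) = false.
  by move=> sk; apply: contraNF nPx => /(H 0 k); apply.
move=> si; rewrite nP // add0n (_ : count P s = 0) //; apply/eqP.
rewrite -leqn0 leqNgt -has_count; apply/negP => /(has_nthP x0)[k sk].
by rewrite (nP k.+1).
Qed.

Section Partition.
Variable la : seq nat.
Hypothesis hla : is_partition la.

Definition nslices := size la + part la 1.
(* Slice [d] is numbered [k = d + size la >= 0], so that no subtraction in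
   these formulas is truncated for rows [1 <= i <= size la]. *)
Definition particle_pos i := part la i + size la - i.
Definition hole_pos j := j.-1 + (size la - conj_part la j).
Definition particle_seq := [seq particle_pos i | i <- iota 1 (size la)].
Definition hole_seq := [seq hole_pos j | j <- iota 1 (part la 1)].

Lemma nth_part_mono j k : j <= k -> nth 0 la k <= nth 0 la j.
Proof.
move=> jk; have /andP[so _] := hla; have [ks|ks] := ltnP k (size la).
  have := @sorted_leq_nth _ geq (fun x y z yx zy => leq_trans zy yx) leqnn 0 la so j k.
  by rewrite !inE (leq_ltn_trans jk ks) ks => /(_ isT isT jk).
by rewrite nth_default.
Qed.

Lemma part_mono i i' : i <= i' -> part la i' <= part la i.
Proof. by move=> ii; apply: nth_part_mono; lia. Qed.

Lemma part_out i : size la < i -> part la i = 0.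
Proof. by move=> il; rewrite /part nth_default //; lia. Qed.

Lemma conj_le j : conj_part la j <= size la. Proof. exact: count_size. Qed.

Lemma part_conj i j : 0 < i -> 0 < j -> (j <= part la i) = (i <= conj_part la j).
Proof.
move=> i0 j0; have [il|il] := leqP i (size la); last first.
  by rewrite part_out //; have := conj_le j; lia.
rewrite /part (@prefix_count _ (fun x => j <= x) 0 la); [by rewrite prednK| |by rewrite prednK].
by move=> k k' /andP[kk' _] /leq_trans; apply; exact: nth_part_mono.
Qed.

Lemma conj_mono j j' : j <= j' -> conj_part la j' <= conj_part la j.
Proof. by move=> jj; apply: sub_count => x /=; exact: leq_trans. Qed.

Lemma mem_cells i j : ((i, j) \in cells la) = (0 < i) && (0 < j <= part la i).
Proof.
apply/allpairsPdep/andP => [[i' [j' [+ + [-> ->]]]]|[i0 /andP[j0 ji]]].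
  by rewrite !mem_iota add1n !ltnS => /andP[-> _] /andP[-> ->].
exists i, j; rewrite !mem_iota; split=> //; last by lia.
by have [//|/part_out e] := leqP i (size la); lia.
Qed.

Lemma cells_uniq : uniq (cells la).
Proof.
apply: allpairs_uniq_dep; first exact: iota_uniq.
  by move=> i _; exact: iota_uniq.
by move=> [i j] [i' j'] _ _ /= [-> ->].
Qed.

Lemma particle_posE i : 0 < i -> i <= size la -> particle_pos i + i = part la i + size la.
Proof. by rewrite /particle_pos; lia. Qed.

Lemma hole_posE j : 0 < j -> hole_pos j + conj_part la j + 1 = j + size la.
Proof. by rewrite /hole_pos; have := conj_le j; lia. Qed.

Lemma particle_pos_lt i i' : 0 < i -> i < i' -> i' <= size la -> particle_pos i' < particle_pos i.
Proof.
move=> i0 ii il; have := part_mono (ltnW ii).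
by have := particle_posE i0 (ltnW (leq_trans ii il)); have := particle_posE (leq_trans i0 (ltnW ii)) il; lia.
Qed.

Lemma hole_pos_lt j j' : 0 < j -> j < j' -> hole_pos j < hole_pos j'.
Proof.
move=> j0 jj; have := conj_mono (ltnW jj).
by have := hole_posE j0; have := hole_posE (leq_trans j0 (ltnW jj)); lia.
Qed.

(** The difference of the positions is [(part la i - j) + (conj_part la j - i) + 1] over the
    integers. By [part_conj] both brackets are non-negative, when it is a hook length, or both are
    negative, so it is never 0. *)
Lemma hole_pos_lt_particle i j : 0 < i -> i <= size la -> 0 < j ->
  (hole_pos j < particle_pos i) = (j <= part la i).
Proof.
move=> i0 il j0; have := part_conj i0 j0; have := particle_posE i0 il; have := hole_posE j0.
by move: (part la i) (conj_part la j) => p c; case: (leqP j p); case: (leqP i c); lia.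
Qed.

Lemma hole_pos_neq_particle i j : 0 < i -> i <= size la -> 0 < j -> hole_pos j != particle_pos i.
Proof.
move=> i0 il j0; have := part_conj i0 j0; have := particle_posE i0 il; have := hole_posE j0.
by move: (part la i) (conj_part la j) => p c; case: (leqP j p); case: (leqP i c); lia.
Qed.

Lemma particle_seq_uniq : uniq particle_seq.
Proof.
rewrite map_inj_in_uniq ?iota_uniq // => i i'; rewrite !mem_iota !add1n !ltnS.
move=> /andP[i0 il] /andP[i0' il'] e.
by have [ii|ii|//] := ltngtP i i'; [have := particle_pos_lt i0 ii il'|have := particle_pos_lt i0' ii il]; lia.
Qed.

Lemma hole_seq_uniq : uniq hole_seq.
Proof.
rewrite map_inj_in_uniq ?iota_uniq // => i i'; rewrite !mem_iota !add1n !ltnS.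
move=> /andP[i0 il] /andP[i0' il'] e.
by have [ii|ii|//] := ltngtP i i'; [have := hole_pos_lt i0 ii|have := hole_pos_lt i0' ii]; lia.
Qed.

(** Disjointness and a count suffice: [part la 1] holes and [size la] particles, all below
    [nslices]. *)
Lemma perm_slices : perm_eq (hole_seq ++ particle_seq) (iota 0 nslices).
Proof.
have sub : {subset hole_seq ++ particle_seq <= iota 0 nslices}.
  move=> k; rewrite mem_cat mem_iota add0n /nslices => /orP[] /mapP[i].
    rewrite mem_iota add1n ltnS => /andP[i0 i1] ->.
    have := hole_posE i0; have := @part_conj 1 i isT i0; rewrite i1; lia.
  rewrite mem_iota add1n ltnS => /andP[i0 i1] ->.
  by have := particle_posE i0 i1; have := @part_mono 1 i i0; lia.
have un : uniq (hole_seq ++ particle_seq).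
  rewrite cat_uniq hole_seq_uniq particle_seq_uniq andbT; apply/hasPn => k /mapP[i].
  rewrite mem_iota add1n ltnS => /andP[i0 i1] ->; apply/negP => /mapP[j].
  rewrite mem_iota add1n ltnS => /andP[j0 j1] e.
  by have := hole_pos_neq_particle i0 i1 j0; rewrite e eqxx.
have sz : size (iota 0 nslices) <= size (hole_seq ++ particle_seq).
  by rewrite size_cat !size_map !size_iota /nslices addnC.
have [_ e] := uniq_min_size un sub sz.
exact: uniq_perm un (iota_uniq _ _) e.
Qed.

Definition is_hole k := k \notin particle_seq.

Lemma filter_hole_seq : perm_eq [seq k <- iota 0 nslices | is_hole k] hole_seq.
Proof.
have /permPl := perm_filter is_hole perm_slices => e; rewrite -e filter_cat.
have -> : seq.filter is_hole particle_seq = [::].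
  by apply/eqP; rewrite -[_ == _]negbK -has_filter; apply/hasPn => k kd; rewrite negbK.
rewrite cats0 (_ : seq.filter is_hole hole_seq = hole_seq) //; apply/all_filterP/allP => k kh.
have := perm_uniq perm_slices; rewrite iota_uniq cat_uniq => /and3P[_ /hasPn h _].
by apply/negP => /h; rewrite kh.
Qed.

Lemma filter_particle_seq : perm_eq [seq k <- iota 0 nslices | ~~ is_hole k] particle_seq.
Proof.
have /permPl := perm_filter (predC is_hole) perm_slices => e; rewrite -e filter_cat.
have -> : seq.filter (predC is_hole) hole_seq = [::].
  apply/eqP; rewrite -[_ == _]negbK -has_filter; apply/hasPn => k kh; rewrite negbK.
  have := perm_uniq perm_slices; rewrite iota_uniq cat_uniq => /and3P[_ /hasPn h _].
  by apply/negP => /h; rewrite kh.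
by rewrite /= (_ : seq.filter _ particle_seq = particle_seq) //; apply/all_filterP/allP => k kh; rewrite /= negbK.
Qed.

(** The particle slices numbered [k] or more each remove one particle, so this is the number of
    particles present before step [k]. *)
Definition diag_rows k := count (fun i => k <= particle_pos i) (iota 1 (size la)).

Lemma leq_diag_rows i k : 0 < i -> i <= size la -> (i <= diag_rows k) = (k <= particle_pos i).
Proof.
move=> i0 il; have si : i.-1 < size (iota 1 (size la)) by rewrite size_iota prednK.
have := @prefix_count _ (fun i => k <= particle_pos i) 0 (iota 1 (size la)) i.-1 _ si.
rewrite prednK // nth_iota ?prednK // add1n prednK // => -> //.
rewrite size_iota => a b /andP[ab bl]; rewrite !nth_iota ?(leq_ltn_trans ab) //.
move=> /leq_trans; apply; have [->//|ab'] := eqVneq a b.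
by apply: ltnW; apply: particle_pos_lt; lia.
Qed.

Lemma diag_rows_le k : diag_rows k <= size la.
Proof. by rewrite -[leqRHS](size_iota 1) count_size. Qed.

Lemma diag_rows0 : diag_rows 0 = size la.
Proof. by rewrite /diag_rows (eq_count (a2 := predT)) // count_predT size_iota. Qed.

Lemma diag_rows_last : diag_rows nslices = 0.
Proof.
apply/eqP; rewrite -leqn0 leqNgt -has_count; apply/hasPn => i.
rewrite mem_iota add1n ltnS => /andP[i0 i1]; rewrite -ltnNge.
by have := particle_posE i0 i1; have := @part_mono 1 i i0; rewrite /nslices; lia.
Qed.

Lemma diag_rowsS k : diag_rows k = diag_rows k.+1 + ~~ is_hole k.
Proof.
rewrite /is_hole negbK -(count_uniq_mem _ particle_seq_uniq) /particle_seq count_map /diag_rows.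
rewrite -!sum1_count big_mkcond [X in _ = X + _]big_mkcond [X in _ = _ + X]big_mkcond -big_split /=.
apply: eq_bigr => i _; rewrite (eq_sym (particle_pos i)); by case: (ltngtP k (particle_pos i)).
Qed.

Lemma count_particles : count (predC is_hole) (iota 0 nslices) = size la.
Proof.
rewrite -size_filter (perm_size filter_particle_seq) size_map size_iota //.
Qed.

Lemma arm_cell i j : (i, j) \in cells la -> arm la (i, j) = part la i - j.
Proof.
rewrite mem_cells => /andP[i0 /andP[j0 ji]].
have il : i <= size la by case: leqP => // /part_out; lia.
rewrite /arm -sum1_count /cells big_mkcond big_allpairs_dep /=.
have ii : i \in iota 1 (size la) by rewrite mem_iota i0 add1n ltnS.
rewrite (bigD1_seq _ ii (iota_uniq _ _)) /=.
rewrite [X in _ + X]big1 => [|i' /negPf ne]; last by rewrite big1 // => j' _; rewrite ne.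
rewrite addn0 -big_mkcond sum1_count eqxx /= -size_filter.
have -> : [seq x <- iota 1 (part la i) | j < x] = iota j.+1 (part la i - j).
  rewrite -[X in iota 1 X](subnKC ji) iotaD filter_cat add1n.
  rewrite (_ : seq.filter _ (iota 1 j) = [::]) /=.
    by apply/all_filterP/allP => x; rewrite mem_iota => /andP[].
  apply/eqP; rewrite -[_ == _]negbK -has_filter; apply/hasPn => x.
  by rewrite mem_iota; lia.
by rewrite size_iota.
Qed.

Lemma leg_cell i j : (i, j) \in cells la -> leg la (i, j) = conj_part la j - i.
Proof.
rewrite mem_cells => /andP[i0 /andP[j0 ji]].
have ic : i <= conj_part la j by rewrite -part_conj.
have cl := conj_le j.
rewrite /leg -sum1_count /cells big_mkcond big_allpairs_dep /=.
transitivity (\sum_(i' <- iota 1 (size la) | i < i' <= conj_part la j) 1).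
  rewrite [RHS]big_mkcond big_seq [RHS]big_seq; apply: eq_bigr => i'.
  rewrite mem_iota add1n ltnS => /andP[i0' i1'].
  rewrite -big_mkcond sum1_count; case: ltnP => ii /=; last by rewrite (eq_count (a2 := pred0)) ?count_pred0 // => x; rewrite /= andbF.
  rewrite (eq_count (a2 := pred1 j)) => [|x]; last by rewrite /= andbT.
  by rewrite count_uniq_mem ?iota_uniq // mem_iota add1n ltnS j0 /= part_conj //; case: leqP.
rewrite sum1_count -size_filter.
have -> : [seq x <- iota 1 (size la) | i < x <= conj_part la j] = iota i.+1 (conj_part la j - i).
  apply: (irr_sorted_eq ltn_trans ltnn).
  - by rewrite sorted_filter //; [exact: ltn_trans|exact: iota_ltn_sorted].
  - exact: iota_ltn_sorted.
  by move=> x; rewrite mem_filter !mem_iota; lia.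
by rewrite size_iota.
Qed.

Lemma hook_cell i j : (i, j) \in cells la -> hook la (i, j) = particle_pos i - hole_pos j /\ hole_pos j < particle_pos i.
Proof.
move=> ij; rewrite /hook arm_cell // leg_cell //; move: ij; rewrite mem_cells.
move=> /andP[i0 /andP[j0 ji]]; have il : i <= size la by case: leqP => // /part_out; lia.
have ic : i <= conj_part la j by rewrite -part_conj.
have := hole_posE j0; have := particle_posE i0 il; lia.
Qed.

End Partition.

(** * Interlacing configurations and the diagonals of a filling *)

Lemma nth_config S i j : config S -> i <= j -> j < size S -> nth 0 S i <= nth 0 S j.
Proof.
move=> /config_sorted so ij js.
have so' : sorted leq S by apply: sub_sorted so => x y /ltnW.
by apply: (sorted_leq_nth leq_trans leqnn 0 so') => //; rewrite inE (leq_ltn_trans ij).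
Qed.

Lemma nth_cnt S i p : config S -> i < size S -> (nth 0 S i <= p) = (i < cnt S p).
Proof.
move=> cS; apply: (@prefix_count _ (fun x => x <= p)) => j k /andP[jk ks] /(leq_trans _).
by apply; exact: nth_config.
Qed.

Lemma cnt_leq S p : config S -> cnt S p <= p.
Proof.
move=> cS; elim: p => [|p IH]; first by rewrite cnt0.
by rewrite cntS ?config_uniq //; case: (_ \in S); lia.
Qed.

Lemma nth_config_ge S i : config S -> i < size S -> i < nth 0 S i.
Proof.
move=> cS iS; have := nth_cnt (nth 0 S i) cS iS; rewrite leqnn => /esym.
by have := cnt_leq (nth 0 S i) cS; lia.
Qed.

Lemma ilaceP A n : config A -> config n -> size n <= size A <= (size n).+1 ->
  reflect ((forall i, i < size n -> nth 0 A i <= nth 0 n i) /\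
           (forall i, i.+1 < size A -> nth 0 n i < nth 0 A i.+1)) (ilace A n).
Proof.
move=> cA cn /andP[sA sn]; apply: (iffP (asboolP _)) => [il|[H1 H2] p].
  split=> i iS.
    rewrite nth_cnt //; last exact: leq_trans sA.
    have /andP[+ _] := il (nth 0 n i); apply: leq_trans.
    by rewrite -nth_cnt.
  have iS' : i < size n by lia.
  have := nth_cnt (nth 0 A i.+1) cA iS; rewrite leqnn => /esym h.
  have /andP[_ +] := il (nth 0 A i.+1); move=> /(leq_trans h); rewrite ltnS -nth_cnt //.
  by have := nth_config_ge cA iS; lia.
apply/andP; split; rewrite leqNgt; apply/negP => h.
  have i1 : cnt A p < size n by apply: leq_trans h _; exact: cnt_size.
  have := h; rewrite -nth_cnt // => /(leq_trans (H1 _ i1)).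
  by rewrite nth_cnt ?ltnn //; exact: leq_trans sA.
have i1 : (cnt n p.-1).+1 < size A by apply: leq_trans h _; exact: cnt_size.
have := h; rewrite -nth_cnt // => /(leq_trans (H2 _ i1)) h2.
have : nth 0 n (cnt n p.-1) <= p.-1 by lia.
by rewrite nth_cnt ?ltnn //; lia.
Qed.

Lemma ilaceE A n p : ilace A n -> cnt n p <= cnt A p <= (cnt n p.-1).+1.
Proof. by move/asboolP. Qed.

Lemma pendingE A n p : ilace A n -> pending A n p + cnt n p = cnt A p.
Proof.
move=> /(@ilaceE _ _ p); rewrite /pending; have := @leq_cnt n p.-1 p (leq_pred p).
by case: ltnP; lia.
Qed.

Lemma pending_inE A n p : ilace A n -> pending_in A n p + cnt n p.-1 = cnt A p.
Proof.
move=> /(@ilaceE _ _ p); rewrite /pending_in; have := @leq_cnt n p.-1 p (leq_pred p).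
by case: ltnP; lia.
Qed.

(** Up to padding, [pending] marks a left face in a hole slice, [~~ pending_in] a right face in a
    particle slice, and membership in [n] a top face. Hence [pending_in], resp. [~~ pending], means
    such a face or a top face, which merges the two types of coupled pairs of a slice into a single
    product. *)
Lemma pending_in_split A n p : config A -> config n -> ilace A n -> pending_in A n p = pending A n p + (p \in n) :> nat.
Proof.
move=> cA cn il; have := pendingE p il; have := pending_inE p il.
case: p => [|p]; first by rewrite (negPf (config0 cn)) !cnt0 //; lia.
rewrite /= (cntS _ (config_uniq cn)).
by case: (pending_in _ _ _) (pending _ _ _) (_ \in n) => [] [] [] /=; lia.
Qed.

(** Double counting: a particle at [s <= N] is seen from the [N - s] positions [s, ..., N - 1]. *)
Lemma sum_cnt S N : config S -> all (fun s => s <= N) S ->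
  \sum_(0 <= p < N) cnt S p + sumn S = size S * N.
Proof.
move=> _; elim: S => [|s S IH] /=; first by rewrite big1.
move=> /andP[sN /IH {}IH]; rewrite mulSn -IH {IH}.
have -> : \sum_(0 <= p < N) cnt (s :: S) p = \sum_(0 <= p < N) (s <= p) + \sum_(0 <= p < N) cnt S p.
  by rewrite -big_split.
suff -> : \sum_(0 <= p < N) (s <= p) = N - s by lia.
rewrite (big_cat_nat (leq0n s) sN) /= [X in X + _]big_nat big1 => [|p /andP[_ ps]]; last by rewrite leqNgt ps.
rewrite add0n big_nat (eq_bigr (fun=> 1)) => [|p /andP[-> _] //].
by rewrite -big_nat sum_nat_const_nat muln1.
Qed.

Lemma config_all_last S N : config S -> last 0 S <= N -> all (fun s => s <= N) S.
Proof. by move=> cS lS; apply/allP => s /(config_last cS) /leq_trans; apply. Qed.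

Lemma vol_exp_hole A n : config A -> config n -> ilace A n -> size A = size n ->
  vol_exp true A n + sumn A = sumn n.
Proof.
move=> cA cn il sAn; pose N := (last 0 A + last 0 n).+1.
have sA' : size A = size n + ~~ true by rewrite addn0.
have [lA ln] : last 0 A <= N /\ last 0 n <= N by rewrite /N; lia.
rewrite (@vol_exp_holeE A n N) //.
have -> : \sum_(1 <= p < N) pending A n p = \sum_(0 <= p < N) pending A n p.
  by rewrite [RHS]big_ltn // /pending !cnt0.
have := sum_cnt cA (config_all_last cA lA); have := sum_cnt cn (config_all_last cn ln).
rewrite sAn => <- /eqP.
rewrite (eq_bigr (fun p => pending A n p + cnt n p)) => [|p _]; last by rewrite pendingE.
by rewrite big_split /=; lia.
Qed.

Lemma vol_exp_particle A n : config A -> config n -> ilace A n -> size A = (size n).+1 ->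
  vol_exp false A n + sumn n + size A = sumn A.
Proof.
move=> cA cn il sAn; pose N := (last 0 A + last 0 n).
have sA' : size A = size n + ~~ false by rewrite addn1.
have [lA ln] : last 0 A <= N /\ last 0 n <= N by rewrite /N; lia.
have := sum_cnt cA (config_all_last cA (leqW lA)); have := sum_cnt cn (config_all_last cn ln).
have -> : \sum_(0 <= p < N.+1) cnt A p = \sum_(1 <= p < N.+1) cnt A p.
  by rewrite big_ltn // cnt0.
rewrite /vol_exp -/N.
have e : \sum_(1 <= p < N.+1) vol_at false A n p + \sum_(1 <= p < N.+1) cnt A p
   = \sum_(0 <= p < N) cnt n p + N.
  rewrite -big_split /= (eq_bigr (fun p => cnt n p.-1 + 1)) => [|p _].
    by rewrite big_split /= sum_nat_const_nat muln1 subn1 big_add1.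
  by rewrite /vol_at; have := pending_inE p il; case: (pending_in _ _ _); lia.
by rewrite sAn mulSn; nia.
Qed.

Section CardFsetI.
Local Open Scope fset_scope.
Lemma card_fsetI_nat (X Y : {fset nat}) N : (forall p, p \in X -> p < N) ->
  #|` X `&` Y| = \sum_(0 <= p < N) ((p \in X) && (p \in Y)).
Proof.
move=> XN; rewrite -[RHS]/(\sum_(0 <= p < N) nat_of_bool _).
transitivity (count (fun p => (p \in X) && (p \in Y)) (iota 0 N)); last first.
  by rewrite -sum1_count big_mkcond /index_iota subn0; apply: eq_bigr => p _; case: ifP.
rewrite -size_filter; apply: perm_size; apply: uniq_perm => [||p].
- exact: fset_uniq.
- by rewrite filter_uniq // iota_uniq.
by rewrite mem_filter mem_iota inE; case pX: (p \in X) => //=; rewrite (XN p pX) andbT.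
Qed.

Lemma card_fsetI_shift (X Y : {fset nat}) (P : pred nat) N : 0 < N ->
  0 \notin X -> (forall p, (p.+1 \in X) = P p) -> P 0 = false ->
  (forall p, N <= p -> P p = false) ->
  #|` X `&` Y| = \sum_(1 <= p < N) (P p && (p.+1 \in Y)).
Proof.
move=> N0 X0 XP P0 PN; rewrite (@card_fsetI_nat _ _ N.+1) => [|[|p]]; last 1 first.
- by rewrite XP ltnS; case: leqP => // /PN ->.
- by rewrite big_nat_recl // (negPf X0) add0n big_ltn // XP P0 add0n; apply: eq_bigr => p _; rewrite XP.
- by rewrite (negPf X0).
Qed.
End CardFsetI.

(** * Diagonals of a filling, their faces and coupled pairs *)

Section Diagonals.
Variable la : seq nat.
Hypothesis hla : is_partition la.
Notation ell := (size la).
Notation diag_rows := (diag_rows la).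
Notation is_hole := (is_hole la).

(* Diagonals of negative content are padded: for [i + k <= size la] the column
   is truncated to 0 and the entry is 0.  Padded rows yield no left or right
   faces, and their fake top faces never meet one ([mem_diag_low]). *)
Definition diag_entry (L : filling la) (k i : nat) : nat := entry L i (i + k - ell).
Definition diag (L : filling la) (k : nat) : seq nat :=
  [seq diag_entry L k i + i | i <- iota 1 (diag_rows k)].

Lemma entryE (L : filling la) (c : cell la) : entry L (val c).1 (val c).2 = L c.
Proof. by rewrite /entry -surjective_pairing valK. Qed.

Lemma entry_out (L : filling la) i j : (i, j) \notin cells la -> entry L i j = 0.
Proof. by move=> ij; rewrite /entry insubN. Qed.

Lemma entry_mono (L : filling la) i j i' j' : RPP la L -> (i', j') \in cells la ->
  i = i' /\ j <= j' \/ j = j' /\ i <= i' -> entry L i j <= entry L i' j'.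
Proof.
move=> rL c' h; have [c|c] := boolP ((i, j) \in cells la); last by rewrite entry_out.
by have := rL (SeqSub c) (SeqSub c') h; rewrite -!entryE.
Qed.

Lemma mem_cells_row k i : 0 < i -> i <= diag_rows k -> ell < i + k -> (i, i + k - ell) \in cells la.
Proof.
move=> i0 ir ik; have il := leq_trans ir (diag_rows_le la k).
rewrite (mem_cells hla) i0; have := leq_diag_rows hla k i0 il; rewrite ir => /esym.
by have := particle_posE hla i0 il; lia.
Qed.

Lemma diag_entry0 L k i : i + k <= ell -> diag_entry L k i = 0.
Proof.
by move=> ik; rewrite /diag_entry (_ : i + k - ell = 0) ?entry_out ?(mem_cells hla) ?andbF //; lia.
Qed.

Lemma diag_entry_le L k i : RPP la L -> 0 < i -> i <= diag_rows k.+1 -> diag_entry L k i <= diag_entry L k.+1 i.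
Proof.
move=> rL i0 ir; have [ik|ik] := leqP (i + k) ell; first by rewrite diag_entry0.
by apply: entry_mono => //; [apply: mem_cells_row|left]; lia.
Qed.

Lemma diag_entry_up L k i : RPP la L -> i.+1 <= diag_rows k -> diag_entry L k.+1 i <= diag_entry L k i.+1.
Proof.
move=> rL ir; have [ik|ik] := leqP (i + k.+1) ell; first by rewrite diag_entry0.
by apply: entry_mono => //; [apply: mem_cells_row|right]; lia.
Qed.

Lemma diag_rows_step k : diag_rows k.+1 <= diag_rows k <= (diag_rows k.+1).+1.
Proof. by rewrite (diag_rowsS hla k); case: (~~ is_hole k) => /=; lia. Qed.

Lemma size_diag L k : size (diag L k) = diag_rows k.
Proof. by rewrite size_map size_iota. Qed.

Lemma nth_diag L k i : i < diag_rows k -> nth 0 (diag L k) i = diag_entry L k i.+1 + i.+1.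
Proof. by move=> ir; rewrite (nth_map 0) ?size_iota // nth_iota // add1n. Qed.

Lemma config_diag L k : RPP la L -> config (diag L k).
Proof.
move=> rL; apply/(pathP 0) => i; rewrite size_diag => ir; rewrite nth_diag //.
case: i ir => [|i] ir /=; first by lia.
rewrite nth_diag; last exact: ltnW.
have := @diag_entry_up L k i.+1 rL ir; have := @diag_entry_le L k i.+1 rL isT.
by have := diag_rows_step k; lia.
Qed.

Lemma ilace_diag L k : RPP la L -> ilace (diag L k) (diag L k.+1).
Proof.
move=> rL; apply/ilaceP; rewrite ?config_diag ?size_diag //; first exact: diag_rows_step.
have := diag_rows_step k => rk.
split=> i ir; rewrite !nth_diag //; try by lia.
  by rewrite leq_add2r; exact: diag_entry_le.
by have := @diag_entry_up L k i.+1 rL ir; lia.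
Qed.

(** Padded rows have entry 0, so row [i] sits at position [i]: the bottom of the diagonal is packed,
    whatever the filling. *)
Lemma cnt_diag_low L m p : RPP la L -> p + m <= ell -> cnt (diag L m) p = p.
Proof.
move=> rL pm; case: p pm => [|p] pm; first by rewrite cnt0 // config_diag.
have pr : p < diag_rows m.
  have pl : p.+1 <= ell by lia.
  by rewrite (leq_diag_rows hla m (ltn0Sn p) pl); have := particle_posE hla (ltn0Sn p) pl; lia.
have := cnt_leq p.+1 (config_diag m rL).
have := @nth_cnt (diag L m) p p.+1 (config_diag m rL); rewrite size_diag pr => /(_ isT).
by rewrite nth_diag // diag_entry0 // add0n leqnn; lia.
Qed.

Definition tops (L : filling la) (k p : nat) : bool :=
  has (fun i => (ell < i + k) && (p == diag_entry L k i + i)) (iota 1 (diag_rows k)).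

Lemma mem_diag L k p : (p \in diag L k) = tops L k p || ((0 < p <= diag_rows k) && (p + k <= ell)).
Proof.
apply/mapP/orP => [[i + ->]|[/hasP[i ii /andP[_ /eqP ->]]|/andP[pr pk]]].
- move=> ii; have [ik|ik] := leqP (i + k) ell.
    by right; rewrite diag_entry0 // add0n ik; move: ii; rewrite mem_iota; lia.
  by left; apply/hasP; exists i; rewrite ?ik ?eqxx.
- by exists i.
by exists p; rewrite ?diag_entry0 // mem_iota; lia.
Qed.

Lemma mem_diagonal m i j :
  ((i, j) \in Defs.diagonal la (m%:Z - ell%:Z)%R) = [&& 0 < i, i <= diag_rows m, ell < i + m & j == i + m - ell].
Proof.
rewrite mem_filter (mem_cells hla) /=; apply/andP/and4P => [[/eqP e /and3P[i0 j0 ji]]|[i0 ir im /eqP ->]].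
  have il : i <= ell by case: leqP => // /(part_out hla); lia.
  by split=> //; rewrite ?leq_diag_rows //; have := particle_posE hla i0 il; lia.
have := mem_cells_row i0 ir im; rewrite (mem_cells hla) => ->.
by split=> //; apply/eqP; lia.
Qed.

Lemma slice_succ (k : nat) : (k%:Z - ell%:Z + 1 = k.+1%:Z - ell%:Z)%R.
Proof. by lia. Qed.

Lemma left_faces0 (L : filling la) d : 0 \notin left_faces L d.
Proof.
rewrite in_fset; apply/allpairsPdep => -[[i j] [h [_ + /=]]].
by rewrite mem_index_iota; lia.
Qed.

Lemma right_faces0 (L : filling la) d : 0 \notin right_faces L d.
Proof.
rewrite in_fset; apply/allpairsPdep => -[[i j] [h [_ + /=]]].
by rewrite mem_index_iota; lia.
Qed.

Lemma mem_left_faces (L : filling la) k p : RPP la L -> is_hole k ->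
  (p.+1 \in left_faces L (k%:Z - ell%:Z)%R) = pending (diag L k) (diag L k.+1) p.
Proof.
move=> rL bk; have rk : diag_rows k = diag_rows k.+1 by rewrite (diag_rowsS hla k) bk addn0.
have cA := config_diag k rL; have cn := config_diag k.+1 rL.
rewrite in_fset slice_succ; apply/allpairsPdep/idP => [[[i j] [h []]]|].
  rewrite mem_diagonal => /and4P[i0 ir ik /eqP ->] /=; rewrite mem_index_iota => /andP[h1 h2] e.
  have i1 : i.-1 < diag_rows k.+1 by lia.
  have j1 : (i + k.+1 - ell).-1 = i + k - ell by lia.
  have := @nth_cnt (diag L k) i.-1 p cA; have := @nth_cnt (diag L k.+1) i.-1 p cn.
  rewrite !size_diag rk => /(_ i1) + /(_ i1); rewrite !nth_diag ?rk // !prednK // /pending.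
  by rewrite /diag_entry -j1; lia.
(* The face lies in row [i + 1], that of the lowest particle of the new diagonal above [p]. *)
rewrite /pending => h; set i := cnt (diag L k.+1) p in h.
have i1 : i < diag_rows k.+1 by rewrite -rk -(size_diag L k); apply: leq_trans h (cnt_size _ _).
have := @nth_cnt (diag L k) i p cA; have := @nth_cnt (diag L k.+1) i p cn.
rewrite !size_diag rk => /(_ i1) + /(_ i1); rewrite !nth_diag ?rk // h ltnn => h1 h2.
have [ik|ik] := leqP (i.+1 + k.+1) ell.
  by move: h1 h2; rewrite !diag_entry0 //; lia.
exists (i.+1, i.+1 + k.+1 - ell), (p - i); split.
- by rewrite mem_diagonal i1 ik eqxx.
- rewrite mem_index_iota /=.
  have -> : (i.+1 + k.+1 - ell).-1 = i.+1 + k - ell by lia.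
  by rewrite -/(diag_entry L k i.+1) -/(diag_entry L k.+1 i.+1); lia.
by move: h2 => /=; lia.
Qed.

Lemma mem_top_faces (L : filling la) k p :
  (p.+1 \in top_faces L (k%:Z - ell%:Z)%R) = tops L k.+1 p.
Proof.
rewrite in_fset slice_succ; apply/mapP/hasP => [[[i j]]|[i]].
  rewrite mem_diagonal => /and4P[i0 ir ik /eqP ->] /= e; exists i.
    by rewrite mem_iota; lia.
  by rewrite ik /diag_entry; apply/eqP; lia.
rewrite mem_iota add1n ltnS => /andP[i0 ir] /andP[ik /eqP ->].
exists (i, i + k.+1 - ell); first by rewrite mem_diagonal i0 ir ik eqxx.
by rewrite /= /diag_entry addn1.
Qed.

(** The guard excludes [p = 0], where [~~ pending_in] holds although there is no face; the exponents
    also start at 1. *)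
Lemma mem_right_faces (L : filling la) k p : RPP la L -> ~~ is_hole k ->
  (p.+1 \in right_faces L (k%:Z - ell%:Z)%R) = (0 < p) && ~~ pending_in (diag L k) (diag L k.+1) p.
Proof.
move=> rL bk; have rk : diag_rows k = (diag_rows k.+1).+1 by rewrite (diag_rowsS hla k) bk addn1.
have cA := config_diag k rL; have cn := config_diag k.+1 rL.
rewrite in_fset -leqNgt; apply/allpairsPdep/andP => [[[i j] [h []]]|[p0]].
  rewrite mem_diagonal => /and4P[i0 ir ik /eqP ->] /=; rewrite mem_index_iota => /andP[h1 h2] e.
  have p0 : 0 < p by lia.
  split=> //; have i1 : i.-1 < diag_rows k by lia.
  have := @nth_cnt (diag L k) i.-1 p cA; rewrite size_diag => /(_ i1).
  rewrite nth_diag // prednK // -/(diag_entry L k i) in h2 *; move=> h3.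
  case: i i0 i1 ik ir h1 h2 h3 e => // -[|i] _ i1 ik ir h1 h2 h3 e; first by lia.
  have i2 : i < diag_rows k.+1 by lia.
  have := @nth_cnt (diag L k.+1) i p.-1 cn; rewrite size_diag => /(_ i2).
  rewrite nth_diag //; move: h1; rewrite /= (_ : i.+2 + k - ell = i.+1 + k.+1 - ell); last by lia.
  by rewrite -/(diag_entry L k.+1 i.+1); lia.
(* Here [i] particles of the new diagonal lie below [p], and particle [i + 1] of the old one lies
   above [p]; its row carries the face. *)
move=> h; set i := cnt (diag L k.+1) p.-1 in h.
have i1 : i < diag_rows k by rewrite rk ltnS -(size_diag L k.+1); exact: cnt_size.
have := @nth_cnt (diag L k) i p cA; rewrite size_diag => /(_ i1); rewrite nth_diag // ltnNge h /= => h1.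
have h2 : entry L i (i.+1 + k - ell) + i < p.
  case E: i i1 h h1 => [|i'] i1 h h1; first by rewrite entry_out ?(mem_cells hla).
  have i2 : i' < diag_rows k.+1 by lia.
  have := @nth_cnt (diag L k.+1) i' p.-1 cn; rewrite size_diag => /(_ i2).
  rewrite nth_diag // /diag_entry (_ : i'.+1 + k.+1 - ell = i'.+2 + k - ell); last by lia.
  by rewrite -/i E; lia.
have [ik|ik] := leqP (i.+1 + k) ell.
  by move: h1; rewrite diag_entry0 //; lia.
exists (i.+1, i.+1 + k - ell), (p - i); split.
- by rewrite mem_diagonal i1 ik eqxx.
- by rewrite mem_index_iota /= -/(diag_entry L k i.+1); lia.
by move=> /=; lia.
Qed.

Local Open Scope fset_scope.
Local Open Scope nat_scope.

Definition slice_pairs (L L' : filling la) (k : nat) : nat :=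
  let d := (k%:Z - ell%:Z)%R in
  if is_hole k then #|` left_faces L d `&` top_faces L' d| + #|` left_faces L d `&` left_faces L' d|
  else #|` right_faces L d `&` right_faces L' d| + #|` top_faces L d `&` right_faces L' d|.

(** Where one filling has a padded row every filling is packed, so the other colour has neither a
    left nor a right face there. *)
Lemma mem_diag_low L L' k p : RPP la L -> RPP la L' -> p \in diag L k.+1 -> ~~ tops L k.+1 p ->
  [/\ 0 < p, pending (diag L' k) (diag L' k.+1) p = false & pending_in (diag L' k) (diag L' k.+1) p].
Proof.
move=> rL rL'; rewrite mem_diag => /orP[->//|/andP[/andP[p0 pr] pk] _].
rewrite /pending /pending_in !cnt_diag_low // ?ltnn ?prednK //; lia.
Qed.

Lemma coupled_exp_slice L L' k : RPP la L -> RPP la L' ->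
  coupled_exp (is_hole k) (diag L k, diag L' k) (diag L k.+1, diag L' k.+1) = slice_pairs L L' k.
Proof.
move=> rL rL'.
have [c1 c2 c3 c4] := And4 (config_diag k rL) (config_diag k.+1 rL) (config_diag k rL') (config_diag k.+1 rL').
have [i1 i2] := (ilace_diag k rL, ilace_diag k rL').
pose N := (last 0 (diag L k) + last 0 (diag L k.+1) + (last 0 (diag L' k) + last 0 (diag L' k.+1))).+1.
have szE M : size (diag M k) = size (diag M k.+1) + ~~ is_hole k by rewrite !size_diag; exact: (diag_rowsS hla).
have tmem M p : tops M k.+1 p -> p \in diag M k.+1 by rewrite mem_diag => ->.
rewrite (@coupled_expE _ _ _ N) //=; try by rewrite /N; lia.
rewrite /slice_pairs; case: (boolP (is_hole k)) (szE) => bk sz; rewrite /coupled_at /=.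
  have P0 : pending (diag L k) (diag L k.+1) 0 = false by rewrite /pending !cnt0.
  have PN p : N <= p -> pending (diag L k) (diag L k.+1) p = false.
    by move=> Np; rewrite (pending_full c1 c2 (sz L)) //; rewrite /N in Np; lia.
  have XP p := mem_left_faces p rL bk.
  rewrite !(card_fsetI_shift _ _ (left_faces0 _ _) XP P0 PN) // -big_split /=.
  apply: eq_bigr => p _; rewrite mem_top_faces mem_left_faces //.
  have := pending_in_split p c3 c4 i2; case: (boolP (tops L' k.+1 p)) => [/tmem ->|nt].
    by case: (pending _ _ p); case: (pending _ _ p); case: (pending_in _ _ p).
  case: (boolP (p \in _)) => [/(mem_diag_low rL' rL)/(_ nt)[_ -> _] //|_].
  by case: (pending _ _ p); case: (pending _ _ p); case: (pending_in _ _ p).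
have Q0 : (0 < 0) && ~~ pending_in (diag L' k) (diag L' k.+1) 0 = false by [].
have QN p : N <= p -> (0 < p) && ~~ pending_in (diag L' k) (diag L' k.+1) p = false.
  by move=> Np; rewrite (pending_in_full c3 c4 (sz L')) ?andbF //; rewrite /N in Np; lia.
have YP p := mem_right_faces p rL' bk.
rewrite (fsetIC (right_faces L _)) (fsetIC (top_faces L _)).
rewrite !(card_fsetI_shift _ _ (right_faces0 _ _) YP Q0 QN) // -big_split /=.
rewrite big_nat [RHS]big_nat; apply: eq_bigr => p /andP[p0 _]; rewrite mem_top_faces mem_right_faces // p0 /=.
have := pending_in_split p c1 c2 i1; case: (boolP (tops L k.+1 p)) => [/tmem ->|nt].
  by case: (pending _ _ p); case: (pending_in _ _ p); case: (pending_in _ _ p).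
case: (boolP (p \in _)) => [/(mem_diag_low rL rL')/(_ nt)[_ _ ->]|_]; first by rewrite !andbF.
by case: (pending _ _ p); case: (pending_in _ _ p); case: (pending_in _ _ p).
Qed.

Lemma coupled_pairsE (L L' : filling la) :
  coupled_pairs L L' = \sum_(0 <= k < nslices la) slice_pairs L L' k.
Proof.
have hs : perm_eq (hole_slices la) [seq (k%:Z - ell%:Z)%R | k <- iota 0 (nslices la) & is_hole k].
  apply: uniq_perm => [||d]; first exact: fset_uniq.
    by rewrite map_inj_uniq ?filter_uniq ?iota_uniq // => k k'; lia.
  rewrite in_fset (perm_mem (perm_map _ (filter_hole_seq hla))) /hole_seq -map_comp.
  congr (d \in _); apply/eq_in_map => j; rewrite mem_iota => /andP[j0 _] /=.
  by have := hole_posE hla j0; lia.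
have ds : perm_eq (particle_slices la) [seq (k%:Z - ell%:Z)%R | k <- iota 0 (nslices la) & ~~ is_hole k].
  apply: uniq_perm => [||d]; first exact: fset_uniq.
    by rewrite map_inj_uniq ?filter_uniq ?iota_uniq // => k k'; lia.
  rewrite in_fset (perm_mem (perm_map _ (filter_particle_seq hla))) /particle_seq -map_comp.
  congr (d \in _); apply/eq_in_map => i; rewrite mem_iota add1n ltnS => /andP[i0 il] /=.
  by have := particle_posE hla i0 il; lia.
rewrite /coupled_pairs (perm_big _ hs) (perm_big _ ds) /= !big_map !big_filter.
rewrite [RHS](bigID is_hole) /= /index_iota subn0 /slice_pairs; congr (_ + _).
  by apply: eq_bigr => k ->.
by apply: eq_bigr => k /negPf ->.
Qed.

Definition dsum (L : filling la) (k : nat) : nat := \sum_(i <- iota 1 (diag_rows k)) diag_entry L k i.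

Lemma sumn_diag L k : sumn (diag L k) = dsum L k + \sum_(i <- iota 1 (diag_rows k)) i.
Proof. by rewrite sumnE big_map big_split. Qed.

Lemma vol_exp_slice L k : RPP la L ->
  vol_exp (is_hole k) (diag L k) (diag L k.+1) + (if is_hole k then dsum L k else dsum L k.+1)
  = if is_hole k then dsum L k.+1 else dsum L k.
Proof.
move=> rL; have := (config_diag k rL, config_diag k.+1 rL, ilace_diag k rL) => -[[c1 c2] il].
have := diag_rowsS hla k; case: (boolP (is_hole k)) => bk /=; rewrite ?addn0 ?addn1 => rk.
  by have := vol_exp_hole c1 c2 il; rewrite !size_diag !sumn_diag rk => /(_ erefl); lia.
have := vol_exp_particle c1 c2 il; rewrite !size_diag !sumn_diag rk => /(_ erefl).
have -> : iota 1 (diag_rows k.+1).+1 = iota 1 (diag_rows k.+1) ++ [:: (diag_rows k.+1).+1].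
  by rewrite -[in LHS](addn1 (diag_rows k.+1)) iotaD add1n.
by rewrite big_cat big_seq1 /=; lia.
Qed.

Lemma dsum0 L : dsum L 0 = 0.
Proof.
rewrite /dsum diag_rows0 big_seq big1 // => i; rewrite mem_iota add1n ltnS => /andP[i0 il].
by rewrite diag_entry0 // addn0.
Qed.

Lemma dsum_last L : dsum L (nslices la) = 0.
Proof. by rewrite /dsum diag_rows_last // big_nil. Qed.

Lemma volumeE (L : filling la) : volume L = \sum_(0 <= k < (nslices la).+1) dsum L k.
Proof.
transitivity (\sum_(c <- cells la) entry L c.1 c.2).
  rewrite /volume (eq_bigr (fun c : cell la => entry L (val c).1 (val c).2)) => [|c _]; last by rewrite entryE.
  rewrite -(big_map (fun c : cell la => val c) predT (fun c => entry L c.1 c.2)).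
  apply: perm_big; apply: uniq_perm.
  - by rewrite map_inj_uniq ?index_enum_uniq //; exact: val_inj.
  - exact: cells_uniq.
  move=> c; apply/mapP/idP => [[x _ ->]|cc]; first exact: valP.
  by exists (SeqSub cc) => //; exact: mem_index_enum.
rewrite /cells big_allpairs_dep /=.
have -> : \sum_(0 <= k < (nslices la).+1) dsum L k =
    \sum_(0 <= k < (nslices la).+1) \sum_(i <- iota 1 ell | i <= diag_rows k) diag_entry L k i.
  apply: eq_bigr => k _; rewrite /dsum.
  rewrite -[in X in _ = \sum_(i <- iota _ X | _) _](subnKC (diag_rows_le la k)).
  rewrite iotaD big_cat /= [X in _ = _ + X]big_seq_cond [X in _ = _ + X]big_pred0 ?addn0 => [|i]; last by rewrite mem_iota; lia.
  by rewrite big_seq [RHS]big_seq_cond; apply: eq_bigl => i; rewrite mem_iota add1n ltnS; lia.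
rewrite (exchange_big_dep predT) //= big_seq [RHS]big_seq; apply: eq_bigr => i.
rewrite mem_iota add1n ltnS => /andP[i0 il].
under [RHS]eq_bigl do rewrite (leq_diag_rows hla) //.
have di := particle_posE hla i0 il; have dn : particle_pos la i < nslices la.
  by have := @part_mono la hla 1 i i0; rewrite /nslices; lia.
have pd : ell - i < (particle_pos la i).+1 by lia.
(* Row [i] meets the diagonals [k] with [ell - i < k <= particle_pos la i]; below that range the
   entries are padding. *)
transitivity (\sum_(0 <= k < (particle_pos la i).+1) diag_entry L k i); last first.
  rewrite [RHS](big_cat_nat (leq0n (particle_pos la i).+1)) /=; last by lia.
  rewrite [X in _ = _ + X]big_nat_cond [X in _ = _ + X]big_pred0 ?addn0 => [|k]; last by lia.
  by rewrite big_nat [RHS]big_nat_cond; apply: eq_bigl => k; lia.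
rewrite (big_cat_nat (leq0n (ell - i).+1)) //=.
have -> : \sum_(0 <= k < (ell - i).+1) diag_entry L k i = 0.
  by rewrite big_nat big1 // => k ki; rewrite diag_entry0 //; lia.
rewrite add0n.
have -> : iota 1 (part la i) = index_iota 1 (part la i).+1 by rewrite /index_iota subn1.
rewrite -[(ell - i).+1]add1n big_addn.
have -> : (particle_pos la i).+1 - (ell - i) = (part la i).+1 by lia.
by apply: eq_big_nat => j /andP[j0 _]; rewrite /diag_entry; congr entry; lia.
Qed.
End Diagonals.

(** * Fillings recovered from interlacing paths *)

Section Filling.
Variable la : seq nat.
Hypothesis hla : is_partition la.
Variable S : nat -> seq nat.
Hypothesis S0 : S 0 = iota 1 (size la).
Hypothesis cS : forall k, k < nslices la -> config (S k.+1).
Hypothesis iS : forall k, k < nslices la -> ilace (S k) (S k.+1).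
Hypothesis sS : forall k, k < nslices la -> size (S k) = size (S k.+1) + ~~ is_hole la k.

Lemma size_path k : k <= nslices la -> size (S k) = diag_rows la k.
Proof.
elim: k => [|k IH] kn; first by rewrite S0 size_iota diag_rows0.
by have := sS kn; rewrite IH ?(ltnW kn) // (diag_rowsS hla); lia.
Qed.

Lemma config_path k : k <= nslices la -> config (S k).
Proof. by case: k => [|k] kn; [rewrite S0 config_iota|exact: cS]. Qed.

Lemma path_le k : k < nslices la ->
  (forall i, i < diag_rows la k.+1 -> nth 0 (S k) i <= nth 0 (S k.+1) i) /\
  (forall i, i.+1 < diag_rows la k -> nth 0 (S k.+1) i < nth 0 (S k) i.+1).
Proof.
move=> kn; have kn' := ltnW kn.
have := iS kn => /(ilaceP (config_path kn') (config_path kn)).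
by rewrite !size_path // => /(_ (diag_rows_step hla k)).
Qed.

(** A squeeze: [nth 0 (S k.+1) i] is less than [nth 0 (S k) i.+1 = i + 2], and at least [i + 1]
    because positions are positive and distinct. So any path has zeros in the padded rows. *)
Lemma nth_path_low k i : k <= nslices la -> i.+1 + k <= size la -> nth 0 (S k) i = i.+1.
Proof.
elim: k i => [|k IH] i kn ik.
  by rewrite S0 nth_iota // -ltnS; lia.
have i1 : i.+1 < diag_rows la k.
  have il : i.+2 <= size la by lia.
  by rewrite (leq_diag_rows hla k (ltn0Sn _) il); have := particle_posE hla (ltn0Sn _) il; lia.
have [_ /(_ i i1)] := path_le kn; rewrite IH ?(ltnW kn) //; last by lia.
have := @nth_config_ge (S k.+1) i (config_path kn); rewrite size_path //.
by have := diag_rows_step hla k; lia.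
Qed.

Lemma fill_exists : exists2 L : filling la, RPP la L &
  forall k, k <= nslices la -> diag L k = S k.
Proof.
pose L : filling la := [ffun c : cell la =>
  nth 0 (S ((val c).2 + size la - (val c).1)) (val c).1.-1 - (val c).1].
have cellP i j : (i, j) \in cells la ->
    [/\ 0 < i, i <= size la, 0 < j & i <= diag_rows la (j + size la - i)]
    /\ j + size la - i <= nslices la.
  rewrite (mem_cells hla) => /and3P[i0 j0 ji].
  have il : i <= size la by case: leqP => // /(part_out hla); lia.
  have p1 := @part_mono la hla 1 i i0.
  split; last by rewrite /nslices; lia.
  by split=> //; rewrite (leq_diag_rows hla) //; have := particle_posE hla i0 il; lia.
have entL i j : (i, j) \in cells la -> entry L i j = nth 0 (S (j + size la - i)) i.-1 - i.
  by move=> ij; have := entryE L (SeqSub ij); rewrite ffunE.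
have diag_entryL k i : k <= nslices la -> i < diag_rows la k -> diag_entry L k i.+1 = nth 0 (S k) i - i.+1.
  move=> kn ir; have [ik|ik] := leqP (i.+1 + k) (size la).
    by rewrite diag_entry0 // nth_path_low // subnn.
  rewrite /diag_entry entL ?mem_cells_row //; congr (nth 0 (S _) _ - _); lia.
have diagL k : k <= nslices la -> diag L k = S k.
  move=> kn; apply: (@eq_from_nth _ 0); rewrite size_diag ?size_path // => i ir.
  rewrite nth_diag // diag_entryL //; have := @nth_config_ge (S k) i (config_path kn).
  by rewrite size_path // => /(_ ir); lia.
exists L => //.
have step1 i j : (i, j) \in cells la -> (i, j.+1) \in cells la -> entry L i j <= entry L i j.+1.
  move=> c c'; rewrite !entL //; have [[i0 il j0 ir] _] := cellP _ _ c; have [[_ _ _ ir'] kn'] := cellP _ _ c'.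
  have e : j.+1 + size la - i = (j + size la - i).+1 by lia.
  rewrite e in ir' kn' *; have [/(_ i.-1) + _] := path_le kn'; rewrite prednK // => /(_ ir'); lia.
have step2 i j : (i, j) \in cells la -> (i.+1, j) \in cells la -> entry L i j <= entry L i.+1 j.
  move=> c c'; rewrite !entL //; have [[i0 il j0 ir] kn] := cellP _ _ c; have [[_ il' _ ir'] _] := cellP _ _ c'.
  have e : j + size la - i = (j + size la - i.+1).+1 by lia.
  rewrite e in ir kn *; have [_ /(_ i.-1)] := path_le kn; rewrite prednK // => /(_ ir') /=; lia.
have mono1 i j d : (i, j) \in cells la -> (i, j + d) \in cells la -> entry L i j <= entry L i (j + d).
  move=> c; elim: d => [|d IH]; first by rewrite addn0.
  rewrite addnS => c'; have c'' : (i, j + d) \in cells la.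
    by move: c c'; rewrite !(mem_cells hla); lia.
  exact: leq_trans (IH c'') (step1 _ _ c'' c').
have mono2 i j d : (i, j) \in cells la -> (i + d, j) \in cells la -> entry L i j <= entry L (i + d) j.
  move=> c; elim: d => [|d IH]; first by rewrite addn0.
  rewrite addnS => c'; have c'' : (i + d, j) \in cells la.
    by move: c c'; rewrite !(mem_cells hla); have := @part_mono la hla (i + d) (i + d).+1 (leqnSn _); lia.
  exact: leq_trans (IH c'') (step2 _ _ c'' c').
move=> [[i j] c] [[i' j'] c'] /=; rewrite -!entryE /= => -[[e jj]|[e ii]].
  by subst i'; rewrite -(subnKC jj); apply: mono1; rewrite ?subnKC.
by subst j'; rewrite -(subnKC ii); apply: mono2; rewrite ?subnKC.
Qed.
End Filling.

Local Open Scope ring_scope.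

Lemma prod_slices (R : comRingType) (la : seq nat) (hla : is_partition la) (f : nat -> R) :
  \prod_(k' <- iota 0 (nslices la) | ~~ is_hole la k') \prod_(k <- iota 0 k' | is_hole la k) f (k' - k)%N
  = \prod_(c : cell la) f (hook la (val c)).
Proof.
transitivity (\prod_(k' <- particle_seq la) \prod_(k <- hole_seq la | (k < k')%N) f (k' - k)%N).
  rewrite -big_filter (perm_big _ (filter_particle_seq hla)).
  rewrite big_seq [RHS]big_seq; apply: eq_bigr => k' kd.
  have kn : (k' < nslices la)%N.
    have : k' \in hole_seq la ++ particle_seq la by rewrite mem_cat kd orbT.
    by rewrite (perm_mem (perm_slices hla)) mem_iota.
  rewrite -[RHS]big_filter -(perm_big _ (perm_filter _ (filter_hole_seq hla))) -filter_predI.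
  rewrite -[LHS]big_filter; apply: congr_big => //.
  rewrite -[in X in _ = seq.filter _ (iota 0 X)](subnKC (ltnW kn)) iotaD filter_cat.
  rewrite [X in _ ++ X](_ : _ = [::]) ?cats0.
    by apply: eq_in_filter => k; rewrite mem_iota add0n /= => ->.
  apply/eqP; rewrite -[_ == _]negbK -has_filter; apply/hasPn => k.
  by rewrite mem_iota /=; case: ltnP => //; lia.
transitivity (\prod_(c <- cells la) f (hook la c)); last first.
  rewrite -(big_map (fun c : cell la => val c) predT (fun c => f (hook la c))).
  apply: perm_big; apply: uniq_perm.
  - exact: cells_uniq.
  - by rewrite map_inj_uniq ?index_enum_uniq //; exact: val_inj.
  move=> c; apply/idP/mapP => [cc|[x _ ->]]; last exact: valP.
  by exists (SeqSub cc) => //; exact: mem_index_enum.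
rewrite [RHS](_ : _ = \prod_(i <- iota 1 (size la)) \prod_(j <- iota 1 (part la i)) f (hook la (i, j))); last first.
  exact: big_allpairs_dep.
rewrite big_map big_seq [RHS]big_seq; apply: eq_bigr => i; rewrite mem_iota add1n ltnS => /andP[i0 il].
rewrite big_map.
have pi1 : (part la i <= part la 1)%N by apply: part_mono.
transitivity (\prod_(j <- iota 1 (part la 1) | (j <= part la i)%N) f (particle_pos la i - hole_pos la j)%N).
  rewrite big_seq_cond [RHS]big_seq_cond; apply: eq_bigl => j; rewrite mem_iota.
  by case: j => //= j; rewrite hole_pos_lt_particle.
rewrite -[in X in iota 1 X](subnKC pi1) iotaD big_cat /= [X in _ * X]big_seq_cond.
rewrite [X in _ * X]big_pred0 ?mulr1 => [|j]; last by rewrite mem_iota; lia.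
rewrite big_seq_cond [RHS]big_seq; apply: eq_big => [j|j].
  by rewrite mem_iota add1n ltnS; lia.
move=> /andP[]; rewrite mem_iota add1n ltnS => /andP[j0 j1] _.
by have [|-> _] := @hook_cell la hla i j; rewrite ?mem_cells // i0 j0.
Qed.

(** * Position-by-position transfer and its intertwiner *)

Section Transfer.
Variables (R : fieldType) (x y t : R).

Definition state_wt := bool -> bool -> bool -> bool -> R.
(* A state is [(u1, v1, u2, v2)], [u] and [v] telling for each colour whether a
   particle of [A], resp. [B], is still unmatched.  [hp_wt] is the weight of
   one position for a hole step followed by a particle step, [ph_wt] for the
   opposite order; capital letters are the states before placing a particle
   and [w1], [w2] the values of [v] before reading [B]. *)
Definition step_wt := bool -> bool -> bool -> bool -> bool ->
                  bool -> bool -> bool -> bool -> bool -> R.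

Definition hp_wt : step_wt := fun u1 v1 U1 V1 w1 u2 v2 U2 V2 w2 =>
  t ^+ (u1 * U2 + V1 * w2)%N * x ^+ (u1 + u2)%N * y ^+ (v1 + v2)%N.
Definition ph_wt : step_wt := fun u1 v1 U1 V1 w1 u2 v2 U2 V2 w2 =>
  t ^+ (~~ u1 * ~~ U2 + ~~ V1 * ~~ w2)%N * x ^+ (~~ V1 + ~~ V2)%N
  * y ^+ (~~ U1 + ~~ U2)%N.

(** Written against the scan: the state after the position and the bits determine the state before
    it, at which [W] is evaluated. *)
Definition tstep1 (f : step_wt) (a1 b1 a2 b2 : bool) (W : state_wt) (n1 n2 : bool) : state_wt :=
  fun u1 v1 u2 v2 =>
  if bits_ok u1 v1 n1 a1 b1 && bits_ok u2 v2 n2 a2 b2 then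
    f u1 v1 (u1 || n1) (v1 || n1) ((v1 || n1) && ~~ b1)
      u2 v2 (u2 || n2) (v2 || n2) ((v2 || n2) && ~~ b2)
    * W ((u1 || n1) && ~~ a1) ((v1 || n1) && ~~ b1)
        ((u2 || n2) && ~~ a2) ((v2 || n2) && ~~ b2)
  else 0.

Definition tstep f a1 b1 a2 b2 (W : state_wt) : state_wt := fun u1 v1 u2 v2 =>
  tstep1 f a1 b1 a2 b2 W false false u1 v1 u2 v2
  + tstep1 f a1 b1 a2 b2 W true false u1 v1 u2 v2
  + (tstep1 f a1 b1 a2 b2 W false true u1 v1 u2 v2
  + tstep1 f a1 b1 a2 b2 W true true u1 v1 u2 v2).

(* Found by solving linear equations on small examples: on each sector with
   fixed [u1 - v1] and [u2 - v2] it is the unique matrix relating the two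
   systems, and it is triangular. *)
Definition intertwiner (W : state_wt) : state_wt := fun u1 v1 u2 v2 =>
  let z := x * y in
  match u1, v1, u2, v2 with
  | true, true, true, true => (z - t^-1) * (z * t - t^-1) * W false false false false
      + (z - t^-1) / t * W false false true true
      + (z - t^-1) * W true true false false + t^-1 * W true true true true
  | true, true, false, false =>
      (z * t - 1) * W false false false false + W true true false false
  | true, true, false, true =>
      (z - t^-1) / t * W false false false true + t^-1 * W true true false true
  | true, true, true, false =>
      (z * t - 1) * W false false true false + W true true true false
  | _, _, true, true => (z - t^-1) * W u1 v1 false false + t^-1 * W u1 v1 true true
  | _, _, false, true => t^-1 * W u1 v1 false true
  | _, _, _, _ => W u1 v1 u2 v2
  end.

(** The matrix does not depend on the bits of [A] and [B], so the relation survives every further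
    position. Each of the 256 cases is an identity linear in the entries of [Wph] with rational
    coefficients. *)
Lemma tstep_intertwiner a1 b1 a2 b2 (Whp Wph : state_wt) : t != 0 ->
  (forall u1 v1 u2 v2, Whp u1 v1 u2 v2 = intertwiner Wph u1 v1 u2 v2) ->
  forall u1 v1 u2 v2, tstep hp_wt a1 b1 a2 b2 Whp u1 v1 u2 v2
    = intertwiner (tstep ph_wt a1 b1 a2 b2 Wph) u1 v1 u2 v2.
Proof.
move=> t0 E u1 v1 u2 v2; rewrite /tstep /tstep1 !E {E}.
by case: a1 b1 a2 b2 u1 v1 u2 v2 => [] [] [] [] [] [] [] [];
  rewrite /intertwiner /bits_ok /hp_wt /ph_wt /=; field.
Qed.
End Transfer.

(** * Summation over the middle configuration *)

Section ConfigWeights.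
Variables (R : fieldType) (f : step_wt R) (w0 : R) (A B : config2).

(** Nothing of [A] is pending at the bottom, but [v] starts true: the first particle of [n] needs
    none of [B] beneath it, as if one stood at the very bottom. *)
Definition start_wt : state_wt R := fun u1 v1 u2 v2 =>
  if [&& ~~ u1, v1, ~~ u2 & v2] then w0 else 0.

Fixpoint total_wt (N : nat) : state_wt R :=
  if N is M.+1 then tstep f (M.+1 \in A.1) (M \in B.1) (M.+1 \in A.2) (M \in B.2) (total_wt M)
  else start_wt.

Fixpoint config_wt (n : config2) (N : nat) : state_wt R :=
  if N is M.+1 then
    tstep1 f (M.+1 \in A.1) (M \in B.1) (M.+1 \in A.2) (M \in B.2) (config_wt n M)
      (M.+1 \in n.1) (M.+1 \in n.2)
  else start_wt.

Lemma eq_config_wt n n' N : (forall p, (p <= N)%N -> (p \in n.1) = (p \in n'.1)) ->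
  (forall p, (p <= N)%N -> (p \in n.2) = (p \in n'.2)) -> config_wt n N = config_wt n' N.
Proof.
elim: N => //= N IH e1 e2; rewrite e1 // e2 // IH // => p pN; [apply: e1|apply: e2]; exact: leqW.
Qed.

Lemma tstep1_sum (I : Type) (s : seq I) a1 b1 a2 b2 (W : I -> state_wt R) n1 n2 u1 v1 u2 v2 :
  \sum_(i <- s) tstep1 f a1 b1 a2 b2 (W i) n1 n2 u1 v1 u2 v2 =
  tstep1 f a1 b1 a2 b2 (fun u1 v1 u2 v2 => \sum_(i <- s) W i u1 v1 u2 v2) n1 n2 u1 v1 u2 v2.
Proof. by rewrite /tstep1; case: ifP => _; [rewrite mulr_sumr|rewrite big1]. Qed.

(** Transfer-matrix principle: the bits of [n] at different positions are independent, so the sum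
    over [n] is taken one position at a time. *)
Lemma sum_config_wt N u1 v1 u2 v2 :
  \sum_(n <- [seq (n1, n2) | n1 <- cfgs N, n2 <- cfgs N]) config_wt n N u1 v1 u2 v2
  = total_wt N u1 v1 u2 v2.
Proof.
elim: N u1 v1 u2 v2 => [|N IH] u1 v1 u2 v2; first by rewrite big_seq1.
rewrite big_allpairs /= big_cat /= big_map.
under eq_bigr do rewrite big_cat /= big_map.
under [X in _ + X]eq_bigr do rewrite big_cat /= big_map.
rewrite !big_split /= /tstep.
have main n1 n2 (g1 g2 : seq nat -> seq nat) :
    (forall s, g1 s = if n1 then rcons s N.+1 else s) ->
    (forall s, g2 s = if n2 then rcons s N.+1 else s) ->
    \sum_(i <- cfgs N) \sum_(j <- cfgs N)
      tstep1 f (N.+1 \in A.1) (N \in B.1) (N.+1 \in A.2) (N \in B.2)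
        (config_wt (g1 i, g2 j) N) (N.+1 \in g1 i) (N.+1 \in g2 j) u1 v1 u2 v2 =
    tstep1 f (N.+1 \in A.1) (N \in B.1) (N.+1 \in A.2) (N \in B.2) (total_wt N) n1 n2 u1 v1 u2 v2.
  move=> g1E g2E.
  have memg (bb : bool) g : (forall s, g s = if bb then rcons s N.+1 else s) ->
      forall s, s \in cfgs N -> (N.+1 \in g s) = bb /\
      forall p, (p <= N)%N -> (p \in g s) = (p \in s).
    move=> gE s; rewrite mem_cfgs gE => /andP[cs ls].
    case: bb {gE}; rewrite ?mem_rcons ?inE ?eqxx; split=> //.
      by move=> p pN; rewrite mem_rcons inE; case: eqP => //; lia.
    by apply/negP => /(config_last cs); lia.
  transitivity (\sum_(i <- cfgs N) \sum_(j <- cfgs N)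
      tstep1 f (N.+1 \in A.1) (N \in B.1) (N.+1 \in A.2) (N \in B.2)
        (config_wt (i, j) N) n1 n2 u1 v1 u2 v2).
    rewrite [LHS]big_seq [RHS]big_seq; apply: eq_bigr => i /(memg _ _ g1E)[e1 e1'].
    rewrite [LHS]big_seq [RHS]big_seq; apply: eq_bigr => j /(memg _ _ g2E)[e2 e2'].
    by rewrite e1 e2 (@eq_config_wt (g1 i, g2 j) (i, j)).
  pose F n := tstep1 f (N.+1 \in A.1) (N \in B.1) (N.+1 \in A.2) (N \in B.2)
    (config_wt n N) n1 n2 u1 v1 u2 v2.
  rewrite -[LHS](big_allpairs (F := F)) tstep1_sum.
  by rewrite /tstep1 IH.
rewrite [RHS]addrACA; congr (_ + _ + (_ + _)); [exact: (main false false id id)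
  |exact: (main false true id (rcons^~ N.+1))|exact: (main true false (rcons^~ N.+1) id)
  |exact: (main true true (rcons^~ N.+1) (rcons^~ N.+1))].
Qed.

(** Since [B] is read one position late, the coupled pairs of the second step are collected at
    [p.-1]. *)
Definition local_wt (n : config2) (p : nat) : R :=
  f (pending A.1 n.1 p) (~~ pending_in n.1 B.1 p) (pending_in A.1 n.1 p) (~~ pending n.1 B.1 p.-1) (~~ pending_in n.1 B.1 p.-1)
    (pending A.2 n.2 p) (~~ pending_in n.2 B.2 p) (pending_in A.2 n.2 p) (~~ pending n.2 B.2 p.-1) (~~ pending_in n.2 B.2 p.-1).

(** For a fixed [n] the counts determine the state at every position, so at most one entry of the
    vector is nonzero. *)
Lemma config_wtE n N u1 v1 u2 v2 :
  [&& config A.1, config B.1 & config n.1] -> [&& config A.2, config B.2 & config n.2] ->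
  config_wt n N u1 v1 u2 v2 =
  if [&& ok_upto A.1 B.1 n.1 N, ok_upto A.2 B.2 n.2 N,
         pending A.1 n.1 N == u1, ~~ pending_in n.1 B.1 N == v1, pending A.2 n.2 N == u2 & ~~ pending_in n.2 B.2 N == v2]
  then w0 * \prod_(1 <= p < N.+1) local_wt n p else 0.
Proof.
move=> /and3P[cA1 cB1 cn1] /and3P[cA2 cB2 cn2].
elim: N u1 v1 u2 v2 => [|N IH] u1 v1 u2 v2.
  by rewrite big_geq // mulr1 /= /start_wt /pending /pending_in /= !cnt0 //.
rewrite [LHS]/= /tstep1 IH !ok_uptoS.
have [ok1|] := boolP (ok_upto A.1 B.1 n.1 N); last by rewrite /= mulr0 if_same.
have [ok2|] := boolP (ok_upto A.2 B.2 n.2 N); last by rewrite /= andbF mulr0 if_same.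
have i1 := ok_upto_state cA1 cB1 cn1 ok1; have i2 := ok_upto_state cA2 cB2 cn2 ok2.
rewrite /= [RHS](_ : _ = if
    [&& ok_at A.1 B.1 n.1 N.+1, pending A.1 n.1 N.+1 == u1 & ~~ pending_in n.1 B.1 N.+1 == v1] &&
    [&& ok_at A.2 B.2 n.2 N.+1, pending A.2 n.2 N.+1 == u2 & ~~ pending_in n.2 B.2 N.+1 == v2]
    then w0 * \prod_(1 <= p < N.+2) local_wt n p else 0); last first.
  congr (if _ then _ else _).
  by case: (ok_at A.1 _ _ _) (ok_at A.2 _ _ _) (_ == u1) (_ == v1) => [] [] [] [].
rewrite (ok_at_step u1 v1 cA1 cB1 cn1 i1) (ok_at_step u2 v2 cA2 cB2 cn2 i2).
have s1 := ok_at_step u1 v1 cA1 cB1 cn1 i1; have s2 := ok_at_step u2 v2 cA2 cB2 cn2 i2.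
have [o1|] := boolP (bits_ok u1 _ _ _ _); last by [].
have [o2|] /= := boolP (bits_ok u2 _ _ _ _); last by rewrite andbF.
rewrite andbA; case: ifP; last by rewrite mulr0.
move=> /andP[h1 h2]; rewrite o1 /= h1 in s1; rewrite o2 /= h2 in s2.
move/and3P: s1 => [k1 /eqP e1 /eqP f1]; move/and3P: s2 => [k2 /eqP e2 /eqP f2].
move/andP: h1 => [_ /eqP g1]; move/andP: h2 => [_ /eqP g2].
have E1 := pending_in_step cA1 cB1 cn1 i1 k1; have F1 := pending_step cA1 cB1 cn1 i1 k1.
have E2 := pending_in_step cA2 cB2 cn2 i2 k2; have F2 := pending_step cA2 cB2 cn2 i2 k2.
rewrite [in RHS]big_nat_recr //= /local_wt /= -g1 -g2 E1 E2 F1 F2 e1 f1 e2 f2.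
by rewrite mulrCA [_ * f _ _ _ _ _ _ _ _ _ _]mulrC.
Qed.
End ConfigWeights.

Section Kernel.
Variables (R : fieldType) (t : R).

Definition kern (b : bool) (r : R) (a n : config2) : R :=
  if [&& config n.1, config n.2, ilace a.1 n.1, ilace a.2 n.2,
         size a.1 == (size n.1 + ~~ b)%N & size a.2 == (size n.2 + ~~ b)%N]
  then r ^+ (vol_exp b a.1 n.1 + vol_exp b a.2 n.2)%N * t ^+ coupled_exp b a n else 0.

Variables (x y : R) (A B n : config2) (N : nat).
Hypotheses (cA1 : config A.1) (cA2 : config A.2) (cB1 : config B.1) (cB2 : config B.2).
Hypotheses (cn1 : config n.1) (cn2 : config n.2).
Hypotheses (lA1 : (last 0 A.1 <= N)%N) (lA2 : (last 0 A.2 <= N)%N).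
Hypotheses (lB1 : (last 0 B.1 < N)%N) (lB2 : (last 0 B.2 < N)%N).
Hypotheses (ln1 : (last 0 n.1 <= N)%N) (ln2 : (last 0 n.2 <= N)%N).
Let N0 : (0 < N)%N. Proof. by apply: leq_trans lB1. Qed.

Lemma ok_upto_ilace2 (e : bool) :
  [&& ok_upto A.1 B.1 n.1 N, ok_upto A.2 B.2 n.2 N, pending A.1 n.1 N == e, ~~ pending_in n.1 B.1 N == e,
      pending A.2 n.2 N == e & ~~ pending_in n.2 B.2 N == e] =
  [&& ilace A.1 n.1, ilace A.2 n.2, size A.1 == (size n.1 + e)%N & size A.2 == (size n.2 + e)%N] &&
  [&& ilace n.1 B.1, ilace n.2 B.2, size n.1 == (size B.1 + ~~ e)%N & size n.2 == (size B.2 + ~~ e)%N].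
Proof.
have := ok_upto_ilace cA1 cB1 cn1 lA1 lB1 ln1 e.
have := ok_upto_ilace cA2 cB2 cn2 lA2 lB2 ln2 e.
move: (ok_upto A.2 _ _ _) (pending A.2 _ _ == _) (~~ pending_in n.2 _ _ == _) (ilace A.2 _) (ilace n.2 _)
   (size A.2 == _) (size n.2 == _) => b1 b2 b3 b4 b5 b6 b7.
move: (ok_upto _ _ _ _) (pending _ _ _ == _) (~~ pending_in _ _ _ == _) (ilace A.1 _) (ilace n.1 _)
   (size A.1 == _) (size n.1 == _) => c1 c2 c3 c4 c5 c6 c7.
move=> E1 E2; transitivity ([&& b1, b2 & b3] && [&& c1, c2 & c3]).
  by case: b1 b2 b3 c1 c2 c3 {E1 E2} => [] [] [] [] [] [].
by rewrite E1 E2; case: b4 b5 b6 b7 c4 c5 c6 c7 {E1 E2} => [] [] [] [] [] [] [] [].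
Qed.

(* The initial weight [t^-1] compensates the position 0 of the particle step,
   which [coupled_exp] does not count. *)
Lemma config_wt_hp : t != 0 ->
  config_wt (hp_wt x y t) t^-1 A B n N false false false false = kern true x A n * kern false y n B.
Proof.
move=> t0; rewrite config_wtE ?cA1 ?cA2 ?cB1 ?cB2 ?cn1 ?cn2 // /kern cn1 cn2 cB1 cB2 ok_upto_ilace2.
case: ifP => [/andP[a1 a2]|]; last first.
  by move=> /= /negbT; rewrite negb_and => /orP[] /negPf ->; rewrite ?mul0r ?mulr0.
rewrite /= a1 a2; case/and4P: a1 => _ _ /eqP s1 /eqP s2; case/and4P: a2 => _ _ /eqP s3 /eqP s4.
have [lB1' lB2'] := (ltnW lB1, ltnW lB2).
rewrite (@vol_expE true A.1 n.1 N) // (@vol_expE true A.2 n.2 N) //.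
rewrite (@vol_expE false n.1 B.1 N) // (@vol_expE false n.2 B.2 N) //.
(* The scan collects coupled pairs of the first step at positions 1 to [N], of the second at 0 to
   [N - 1]. *)
rewrite (@coupled_expE true A n N.+1) ?(leqW _) // (@coupled_expE false n B N) //.
rewrite /local_wt /hp_wt !big_split /= !prodrXr !big_split /= !exprD.
rewrite (sum_nat_predn (fun p => ~~ pending n.1 B.1 p * ~~ pending_in n.2 B.2 p)%N N0) exprD.
have -> : (~~ pending n.1 B.1 0 * ~~ pending_in n.2 B.2 0 = 1)%N by rewrite /pending /pending_in /= !cnt0.
rewrite expr1 (eq_bigr (fun p => pending A.1 n.1 p && pending_in A.2 n.2 p : nat)) => [|p _]; last exact: mulnb.
rewrite [X in t * (t ^+ X)](eq_bigr (fun p => ~~ pending n.1 B.1 p && ~~ pending_in n.2 B.2 p : nat)) => [|p _]; last exact: mulnb.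
by field.
Qed.

(** The initial weight is 1: at position 0 nothing of [n] is pending, so the hole step contributes
    neither [x] nor [t] there. *)
Lemma config_wt_ph :
  config_wt (ph_wt x y t) 1 A B n N true true true true = kern false y A n * kern true x n B.
Proof.
rewrite config_wtE ?cA1 ?cA2 ?cB1 ?cB2 ?cn1 ?cn2 // /kern cn1 cn2 cB1 cB2 ok_upto_ilace2.
case: ifP => [/andP[a1 a2]|]; last first.
  by move=> /= /negbT; rewrite negb_and => /orP[] /negPf ->; rewrite ?mul0r ?mulr0.
rewrite /= a1 a2; case/and4P: a1 => _ _ /eqP s1 /eqP s2; case/and4P: a2 => _ _ /eqP s3 /eqP s4.
have [lB1' lB2'] := (ltnW lB1, ltnW lB2).
rewrite (@vol_expE false A.1 n.1 N) // (@vol_expE false A.2 n.2 N) //.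
rewrite (@vol_exp_holeE n.1 B.1 N) ?(@vol_exp_holeE n.2 B.2 N) //; try by rewrite ?s3 ?s4 addn0.
rewrite (@coupled_expE false A n N.+1) ?(leqW _) // (@coupled_expE true n B N) //.
rewrite /local_wt /ph_wt !big_split /= !prodrXr !big_split /= !exprD.
rewrite (sum_nat_predn (fun p => ~~ ~~ pending n.1 B.1 p * ~~ ~~ pending_in n.2 B.2 p)%N N0).
rewrite (sum_nat_predn (fun p => ~~ ~~ pending n.1 B.1 p : nat) N0).
rewrite (sum_nat_predn (fun p => ~~ ~~ pending n.2 B.2 p : nat) N0).
have u10 : pending n.1 B.1 0 = false by rewrite /pending !cnt0.
have u20 : pending n.2 B.2 0 = false by rewrite /pending !cnt0.
rewrite u10 u20 /= mul0n !add0n.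
rewrite (eq_bigr (fun p => ~~ pending A.1 n.1 p && ~~ pending_in A.2 n.2 p : nat)) => [|p _]; last exact: mulnb.
rewrite [X in _ * t ^+ X](eq_bigr (fun p => pending n.1 B.1 p && pending_in n.2 B.2 p : nat)) => [|p _]; last by rewrite !negbK mulnb.
rewrite [X in x ^+ X](eq_bigr (fun p => pending n.1 B.1 p : nat)) => [|p _]; last by rewrite negbK.
rewrite [X in _ * x ^+ X](eq_bigr (fun p => pending n.2 B.2 p : nat)) => [|p _]; last by rewrite negbK.
by ring.
Qed.
End Kernel.

(** * The Cauchy identity *)

Section ESum.
Variable R : realType.
Local Open Scope ereal_scope.

(** For finite [c > 0] the inequality [half], used for [c] and for its inverse, gives both
    directions; for [c = +oo] one asks whether some term is nonzero. *)
Lemma esumZl (T : choiceType) (S : set T) (c : \bar R) (a : T -> \bar R) :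
  0 <= c -> (forall i, 0 <= a i) ->
  \esum_(i in S) (c * a i) = c * \esum_(i in S) a i.
Proof.
move=> c0 a0.
have half (r : R) (b : T -> \bar R) : (0 < r)%R -> (forall i, 0 <= b i) ->
    \esum_(i in S) (r%:E * b i) <= r%:E * \esum_(i in S) b i.
  move=> r0 b0; apply: ge_ereal_sup => _ [X [finX XS] <-].
  rewrite -ge0_mule_fsumr // lee_pmul2l ?lte_fin //.
  by apply: ereal_sup_ubound; exists X.
case: c c0 => [r| |//].
  rewrite lee_fin le_eqVlt => /predU1P[<-|r0].
    by rewrite mul0e esum1 // => i _; rewrite mul0e.
  apply/eqP; rewrite eq_le half //=.
  rewrite -lee_pdivlMl // (le_trans _ (half r^-1%R _ _ _)) ?invr_gt0 //.
    by apply: le_esum => i _; rewrite muleA -EFinM mulVf ?gt_eqF // mul1e.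
  by move=> i; rewrite mule_ge0 // lee_fin ltW.
move=> _; have [a00|] := pselect (forall i, S i -> a i = 0).
  by rewrite !esum1 ?mule0 // => i /a00 ->; rewrite mule0.
move=> /existsNP[i /not_implyP[Si /eqP ai]].
have ai0 : 0 < a i by rewrite lt_neqAle eq_sym ai a0.
have pos (b : T -> \bar R) : b i <= \esum_(i in S) b i.
  apply: esum_ge; exists [set i]%classic; last by rewrite fsbig_set1.
  by split => // _ ->.
rewrite gt0_mulye ?(lt_le_trans ai0) //.
by apply/eqP; rewrite -leye_eq (le_trans _ (pos _)) // gt0_mulye.
Qed.

Lemma esum_exchange (T1 T2 : choiceType) (a : T1 -> T2 -> \bar R) :
  (forall i j, 0 <= a i j) ->
  \esum_(i in [set: T1]) \esum_(j in [set: T2]) a i j =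
  \esum_(j in [set: T2]) \esum_(i in [set: T1]) a i j.
Proof.
move=> a0; rewrite !esum_esum //.
rewrite (reindex_esum [set: T2 * T1] _ (fun k => (k.2, k.1))) /=; last first.
  split=> //= [[i j] [i' j'] _ _ [-> ->] //|[i j] _]; by exists (j, i).
by apply: congr2; [apply/seteqP; split|].
Qed.

Lemma esum_exhaust (T : choiceType) (s : nat -> seq T) (F : T -> R) (L : R) :
  (forall N, uniq (s N)) -> (forall i, (0 <= F i)%R) ->
  (forall M N, (M <= N)%N -> {subset s M <= s N}) ->
  (forall i, F i != 0%R -> exists N, i \in s N) ->
  (forall e, (0 < e)%R -> exists N0, forall N, (N0 <= N)%N ->
     (`|\sum_(i <- s N) F i - L| < e)%R) ->
  \esum_(i in [set: T]) (F i)%:E = L%:E.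
Proof.
move=> us F0 sS Fs lim; apply/eqP; rewrite eq_le; apply/andP; split.
  apply: ge_ereal_sup => _ [X [finX _] <-].
  pose Y := (X `&` [set i | F i != 0%R])%classic.
  have -> : \sum_(i \in X) (F i)%:E = \sum_(i \in Y) (F i)%:E.
    apply: esym; apply: fsbig_widen; first exact: subIsetl.
    move=> i /= [Xi Yi]; congr EFin; apply/eqP/negPn/negP => Fi; exact: Yi.
  have finY : finite_set Y by exact: finite_setIl.
  have [N YN] : exists N, forall i, Y i -> i \in s N.
    suff [N YN] : exists N, {subset (fset_set Y : seq T) <= s N}.
      by exists N => i Yi; apply: YN; rewrite in_fset_set // inE.
    have : {in (fset_set Y : seq T), forall i, F i != 0%R}.
      by move=> i; rewrite in_fset_set // inE => -[].
    elim: (fset_set Y : seq T) => [|i r IH] Yr; first by exists 0%N.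
    have [|N1 iN1] := IH; first by move=> j jr; apply: Yr; rewrite inE jr orbT.
    have [N2 iN2] := Fs i (Yr i (mem_head _ _)).
    exists (maxn N1 N2) => j; rewrite inE => /predU1P[->|/iN1].
      by apply: sS iN2; exact: leq_maxr.
    by apply: sS; exact: leq_maxl.
  apply/lee_addgt0Pr => e e0; have [N0 HN0] := lim e e0.
  pose M := maxn N N0.
  apply: (@le_trans _ _ (\sum_(i <- s M) (F i)%:E)).
    rewrite [leRHS]fsbig_seq //; apply: lee_fsum_nneg_subset => //.
    - move=> i; rewrite !inE => /YN /= iN; apply: sS iN; exact: leq_maxl.
    - by move=> i _; rewrite lee_fin.
  rewrite sumEFin -EFinD lee_fin.
  have := HN0 M (leq_maxr _ _); rewrite ltr_norml => /andP[_]; lra.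
apply/lee_subgt0Pr => e e0; have [N0 HN0] := lim e e0.
apply: esum_ge; exists [set` s N0]%classic; first by [].
rewrite -[leRHS]fsbig_seq // sumEFin -EFinB lee_fin.
by have := HN0 N0 (leqnn _); rewrite ltr_norml => /andP[]; lra.
Qed.
End ESum.

Section AffineLimit.
Variable R : realType.

(* Any ratio strictly between [max r z] and [1] dominates the error. *)
Lemma perturbed_geometric (e : nat -> R) (r z c : R) :
  0 <= r < 1 -> 0 <= z < 1 -> (forall k, e k.+1 = r * e k + c * z ^+ k) ->
  forall eps, 0 < eps -> exists k0, forall k, (k0 <= k)%N -> `|e k| < eps.
Proof.
move=> /andP[r0 r1] /andP[z0 z1] ek eps eps0.
pose m := Num.max r z; pose s := (m + 1) / 2.
have [rm zm] : r <= m /\ z <= m by rewrite !le_max !lexx orbT.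
have m1 : m < 1 by rewrite gt_max r1 z1.
have [rs zs s1] : [/\ r < s, z <= s & s < 1] by rewrite /s; split; lra.
have s0 : 0 < s by lra.
(* Large enough for the start of the induction [bnd] and for [Cc], which closes its step. *)
pose C : R := `|e 0%N| + `|c| / (s - r) + 1.
have d0 : 0 < s - r by lra.
have C0 : 0 < C by rewrite /C ltr_wpDl // addr_ge0 // divr_ge0 // ltW.
have Cc : `|c| <= C * (s - r).
  rewrite -ler_pdivrMr // /C -addrA ler_wpDl // lerDl; lra.
have bnd k : `|e k| <= C * s ^+ k.
  elim: k => [|k IH].
    by rewrite expr0 mulr1 /C -addrA lerDl addr_ge0 // divr_ge0 // ltW.
  rewrite ek (le_trans (ler_normD _ _)) // !normrM (ger0_norm r0) normrX (ger0_norm z0).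
  apply: (@le_trans _ _ (r * (C * s ^+ k) + C * (s - r) * s ^+ k)).
    apply: lerD; first exact: ler_wpM2l.
    apply: ler_pM => //; first exact: exprn_ge0.
    by apply: lerXn2r => //; rewrite nnegrE // ltW.
  by rewrite exprSr; lra.
have /cvgrPdist_lt : (s ^+ k @[k --> \oo] --> (0 : R))%classic.
  by apply: cvg_expr; rewrite gtr0_norm.
move=> /(_ (eps / C)) []; first exact: divr_gt0.
move=> k0 _ Hk; exists k0 => k kk0; have := Hk k kk0.
rewrite /= sub0r normrN gtr0_norm ?exprn_gt0 // ltr_pdivlMr // mulrC => h.
exact: le_lt_trans (bnd k) h.
Qed.
End AffineLimit.

Lemma leq_sum4 (a b c d N : nat) : ((a + b + c + d).+1 <= N)%N ->
  [/\ (a <= N)%N, (b <= N)%N, (c < N)%N & (d < N)%N] /\ ((a < N)%N /\ (b < N)%N).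
Proof. by move=> h; do !split; lia. Qed.

Section FreeStep.
Variables (R : fieldType) (x y t : R) (W : state_wt R).
Let W' := tstep (ph_wt x y t) false false false false W.

(** Above the outer particles a pair [true true] means that this colour may still place its extra
    particle, and waiting costs nothing while neither colour has done so. *)
Lemma tstep_ph_pending : W' true true true true = W true true true true.
Proof. by rewrite /W' /tstep /tstep1 /bits_ok /ph_wt /=; ring. Qed.

Lemma tstep_ph_blue :
  W' false false true true = x * y * W false false true true + W true true true true.
Proof. by rewrite /W' /tstep /tstep1 /bits_ok /ph_wt /=; ring. Qed.

Lemma tstep_ph_red :
  W' true true false false = x * y * W true true false false + W true true true true.
Proof. by rewrite /W' /tstep /tstep1 /bits_ok /ph_wt /=; ring. Qed.

Lemma tstep_ph_placed : W' false false false false =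
  (x * y * t) ^+ 2 * W false false false false + x * y * W false false true true
  + x * y * t * W true true false false + W true true true true.
Proof. by rewrite /W' /tstep /tstep1 /bits_ok /ph_wt /=; ring. Qed.
End FreeStep.

Section Cauchy.
Variables (R : realType) (x y t : R).
Hypotheses (x0 : 0 < x) (y0 : 0 < y) (t0 : 0 < t) (z1 : x * y < 1) (zt1 : x * y * t < 1).
Variables (A B : config2).
Hypotheses (cA1 : config A.1) (cA2 : config A.2) (cB1 : config B.1) (cB2 : config B.2).

Let N0 := (last 0 A.1 + last 0 A.2 + last 0 B.1 + last 0 B.2).+1.
Let cfgs2 N := [seq (n1, n2) | n1 <- cfgs N, n2 <- cfgs N].

Let cfgs2P N n : n \in cfgs2 N ->
  [/\ config n.1, config n.2, (last 0 n.1 <= N)%N & (last 0 n.2 <= N)%N].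
Proof.
by move=> /allpairsP[[n1 n2] [/= + + ->]]; rewrite !mem_cfgs => /andP[? ?] /andP[? ?].
Qed.

Let mem_cfgs2 N n : config n.1 -> config n.2 ->
  (last 0 n.1 <= N)%N -> (last 0 n.2 <= N)%N -> n \in cfgs2 N.
Proof.
move=> c1 c2 l1 l2; apply/allpairsP; exists (n.1, n.2).
by rewrite !mem_cfgs c1 c2 l1 l2; case: (n).
Qed.

Let Whp := total_wt (hp_wt x y t) t^-1 A B.
Let Wph := total_wt (ph_wt x y t) 1 A B.

Lemma total_wt_intertwiner N u1 v1 u2 v2 : Whp N u1 v1 u2 v2 = intertwiner x y t (Wph N) u1 v1 u2 v2.
Proof.
elim: N u1 v1 u2 v2 => [|N IH] u1 v1 u2 v2; last first.
  by apply: tstep_intertwiner => //; rewrite gt_eqF.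
(* On the start state the intertwiner multiplies by [t^-1], which is the ratio of the two initial
   weights. *)
rewrite /Whp /Wph /= /start_wt; case: u1 v1 u2 v2 => [] [] [] [];
  by rewrite /intertwiner /= ?mulr0 ?mulr1 ?addr0.
Qed.

Lemma sum_kern_hp N : (N0 <= N)%N ->
  \sum_(n <- cfgs2 N) kern t true x A n * kern t false y n B = Whp N false false false false.
Proof.
move=> NN; rewrite /Whp -sum_config_wt big_seq [RHS]big_seq; apply: eq_bigr => n /cfgs2P[c1 c2 l1 l2].
by have [[? ? ? ?] _] := leq_sum4 NN; rewrite config_wt_hp // gt_eqF.
Qed.

Lemma sum_kern_ph N : (N0 <= N)%N ->
  \sum_(n <- cfgs2 N) kern t false y A n * kern t true x n B = Wph N true true true true.
Proof.
move=> NN; rewrite /Wph -sum_config_wt big_seq [RHS]big_seq; apply: eq_bigr => n /cfgs2P[c1 c2 l1 l2].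
by have [[? ? ? ?] _] := leq_sum4 NN; rewrite config_wt_ph.
Qed.

Let M := Wph N0 true true true true.
Let c := ((1 - x * y) * (1 - x * y * t))^-1.

Lemma Wph_step N : (N0 <= N)%N -> Wph N.+1 = tstep (ph_wt x y t) false false false false (Wph N).
Proof.
move=> NN; rewrite /Wph /=.
have out (S : seq nat) p : config S -> (last 0 S < p)%N -> p \in S = false.
  by move=> cS lp; apply/negP => /(config_last cS); rewrite leqNgt lp.
by have [[? ? ? ?] [? ?]] := leq_sum4 NN; rewrite !out // ltnW.
Qed.

Lemma Wph_M N : (N0 <= N)%N -> Wph N true true true true = M.
Proof.
move=> NN; rewrite -(subnKC NN); elim: (N - N0)%N => [|k IH]; first by rewrite addn0.
by rewrite addnS Wph_step ?leq_addr // tstep_ph_pending.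
Qed.

Lemma Wph_lim (eps : R) : 0 < eps -> exists K, forall N, (K <= N)%N ->
  `|Wph N false false false false - c * M| < eps.
Proof.
pose z := x * y; have z0 : 0 < z by rewrite mulr_gt0.
pose P k := Wph (N0 + k) false false true true.
pose Q k := Wph (N0 + k) true true false false.
pose Z k := Wph (N0 + k) false false false false.
have z1' : 1 - z != 0 by rewrite subr_eq0 eq_sym lt_eqF.
have zt1' : 1 - z * t != 0 by rewrite subr_eq0 eq_sym lt_eqF.
have MN k : Wph (N0 + k) true true true true = M by apply: Wph_M; exact: leq_addr.
have stepE k : Wph (N0 + k.+1) = tstep (ph_wt x y t) false false false false (Wph (N0 + k)).
  by rewrite addnS Wph_step // leq_addr.
have PE k : P k.+1 = z * P k + M.
  by rewrite /P stepE tstep_ph_blue MN.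
have QE k : Q k.+1 = z * Q k + M.
  by rewrite /Q stepE tstep_ph_red MN.
have ZE k : Z k.+1 = (z * t) ^+ 2 * Z k + z * P k + z * t * Q k + M.
  by rewrite /Z stepE tstep_ph_placed MN.
(* The recursions of [P] and [Q] have the fixed point [L]; with it inserted, that of [Z] has the
   fixed point [c * M], and the remaining error [d * z ^+ k] decays. *)
pose L := M / (1 - z).
have Pk k : P k - L = z ^+ k * (P 0%N - L).
  elim: k => [|k IH]; first by rewrite expr0 mul1r.
  rewrite PE exprS -mulrA -IH /L; by field.
have Qk k : Q k - L = z ^+ k * (Q 0%N - L).
  elim: k => [|k IH]; first by rewrite expr0 mul1r.
  rewrite QE exprS -mulrA -IH /L; by field.
pose d := z * (P 0%N - L) + z * t * (Q 0%N - L).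
have ek k : Z k.+1 - c * M = (z * t) ^+ 2 * (Z k - c * M) + d * z ^+ k.
  have -> : d * z ^+ k = z * (P k - L) + z * t * (Q k - L) by rewrite Pk Qk /d; ring.
  by rewrite ZE /L /c -/z; field; rewrite z1' zt1'.
move=> eps0.
have zt0 : 0 <= z * t by rewrite mulr_ge0 // ltW.
have [||k0 Hk] := perturbed_geometric (e := fun k => Z k - c * M) _ _ ek eps0.
- by rewrite exprn_ge0 //= exprn_ilt1 // ?ltW.
- by rewrite (ltW z0).
exists (N0 + k0)%N => N NN; have := Hk (N - N0)%N; rewrite /Z subnKC.
  by apply; rewrite leq_subRL // (leq_trans _ NN) // leq_addr.
by rewrite (leq_trans _ NN) // leq_addr.
Qed.

Lemma kern_ge0 b r a n : 0 < r -> 0 <= kern t b r a n.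
Proof. by move=> r0; rewrite /kern; case: ifP => // _; rewrite mulr_ge0 // exprn_ge0 // ltW. Qed.

Let sub_cfgs2 K N : (K <= N)%N -> {subset cfgs2 K <= cfgs2 N}.
Proof.
move=> KN n /cfgs2P[c1 c2 l1 l2]; apply: mem_cfgs2 => //.
  exact: leq_trans l1 KN.
exact: leq_trans l2 KN.
Qed.

Let cfgs2_uniq N : uniq (cfgs2 N).
Proof. by apply: allpairs_uniq; [exact: cfgs_uniq|exact: cfgs_uniq|move=> [? ?] [? ?] _ _ [-> ->]]. Qed.

Let kern_cfgs b r a n : kern t b r a n != 0 -> exists N, n \in cfgs2 N.
Proof.
rewrite /kern; case: ifP => [/and5P[c1 c2 _ _ _] _|]; last by rewrite eqxx.
by exists (last 0 n.1 + last 0 n.2)%N; apply: mem_cfgs2; rewrite ?leq_addr ?leq_addl.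
Qed.

Lemma kern_cauchy :
  (\esum_(n in [set: config2]) (kern t true x A n * kern t false y n B)%:E =
   c%:E * \esum_(m in [set: config2]) (kern t false y A m * kern t true x m B)%:E)%E.
Proof.
rewrite (@esum_exhaust _ _ cfgs2 _ (c * M)) //; last first.
- move=> e e0; have [K HK] := Wph_lim e0; exists (maxn N0 K) => N; rewrite geq_max => /andP[NN KN].
  (* At the all-false state the intertwiner is the identity, so this is an entry of [Wph]. *)
  by rewrite sum_kern_hp // total_wt_intertwiner /=; exact: HK.
- by move=> n; rewrite mulf_eq0 negb_or => /andP[/kern_cfgs].
- by move=> n; rewrite mulr_ge0 // kern_ge0.
rewrite (@esum_exhaust _ _ cfgs2 _ M) //; last first.
- move=> e e0; exists N0 => N NN; rewrite sum_kern_ph // Wph_M // subrr normr0 //.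
- by move=> n; rewrite mulf_eq0 negb_or => /andP[/kern_cfgs].
- by move=> n; rewrite mulr_ge0 // kern_ge0.
Qed.
End Cauchy.

(** * Sorting the word of slices *)

Section KernBase.
Variables (R : fieldType) (t r : R).

(** The step is forced by [ilace_iotaP], and it has weight 1 because [pending_in] holds at every
    positive position. *)
Lemma kern_iota k n :
  kern t false r (iota 1 k.+1, iota 1 k.+1) n = (n == (iota 1 k, iota 1 k))%:R.
Proof.
rewrite /kern /= !addn1 !size_iota !eqSS -pair_eqE /pair_eq /=.
case: n => n1 n2 /=.
have bad (s : seq nat) (P : pred (seq nat)) : P (iota 1 k) -> ~~ P s -> (s == iota 1 k) = false.
  by move=> Pk; apply: contraNF => /eqP ->.
have [c1|c1] := boolP (config n1); last by rewrite (bad _ config (config_iota k) c1).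
have [c2|c2] := boolP (config n2); last by rewrite (bad _ config (config_iota k) c2) andbF.
have ks : k == size (iota 1 k) by rewrite size_iota.
have [s1|s1] := eqVneq k (size n1); last by rewrite (bad _ (fun s => k == size s)) // !andbF.
have [s2|s2] := eqVneq k (size n2); last by rewrite (bad n2 (fun s => k == size s)) // !andbF.
rewrite !ilace_iotaP // !andbT; case: eqP => //= ->; case: eqP => //= ->.
have U1 p : (0 < p)%N -> pending_in (iota 1 k.+1) (iota 1 k) p.
  by rewrite /pending_in !cnt_iota => p0; lia.
by rewrite /vol_exp /coupled_exp !big_nat !big1 ?mulr1 // => p /andP[p0 _];
  rewrite /coupled_at /vol_at U1 ?andbF.
Qed.

Lemma kern_nil n : kern t true r ([::], [::]) n = (n == ([::], [::]))%:R.
Proof.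
rewrite /kern /= !addn0; case: n => [[|i n1] [|j n2]] /=; rewrite ?andbF //.
rewrite /vol_exp /coupled_exp /= !big_geq // mulr1.
by have -> : ilace [::] [::] by apply/asboolP.
Qed.
End KernBase.

Section Path.
Variables (R : realType) (t : R).
Hypothesis t0 : 0 < t.

Fixpoint zpath (w : seq (bool * R)) (a : config2) : \bar R :=
  if w is s :: w' then
    (\esum_(n in [set: config2]) ((kern t s.1 s.2 a n)%:E * zpath w' n))%E
  else (a == ([::], [::]))%:R%:E.

Lemma zpath_consE b r w a : zpath ((b, r) :: w) a =
  (\esum_(n in [set: config2]) ((kern t b r a n)%:E * zpath w n))%E.
Proof. by []. Qed.

Definition positive_word (w : seq (bool * R)) := all (fun s => 0 < s.2) w.

Lemma zpath_ge0 w a : positive_word w -> (0 <= zpath w a)%E.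
Proof.
elim: w a => [|s w IH] a /=; first by rewrite lee_fin ler0n.
by move=> /andP[s0 w0]; apply: esum_ge0 => n _; rewrite mule_ge0 ?IH // lee_fin kern_ge0.
Qed.

Lemma kern_out b r a n : ~~ (config n.1 && config n.2) -> kern t b r a n = 0.
Proof. by rewrite /kern; case: (config n.1) (config n.2) => [] []. Qed.

Definition cauchy_factor (z : R) : R := ((1 - z) * (1 - z * t))^-1.

(** With the configuration [m] after both steps summed outermost, [kern_cauchy] applies to the inner
    sum; the rearrangement is free for non-negative terms. *)
Lemma zpath_swap x y w a : 0 < x -> 0 < y -> positive_word w -> x * y < 1 -> x * y * t < 1 ->
  config a.1 && config a.2 ->
  (zpath ((true, x) :: (false, y) :: w) a =
   (cauchy_factor (x * y))%:E * zpath ((false, y) :: (true, x) :: w) a)%E.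
Proof.
move=> x0 y0 w0 z1 zt1 /andP[ca1 ca2] /=.
have flat b1 r1 b2 r2 : 0 < r1 -> 0 < r2 ->
    (\esum_(n in [set: config2]) ((kern t b1 r1 a n)%:E *
       \esum_(m in [set: config2]) ((kern t b2 r2 n m)%:E * zpath w m)) =
     \esum_(m in [set: config2]) (zpath w m *
       \esum_(n in [set: config2]) (kern t b1 r1 a n * kern t b2 r2 n m)%:E))%E.
  move=> r10 r20; transitivity (\esum_(n in [set: config2]) \esum_(m in [set: config2])
      (zpath w m * (kern t b1 r1 a n * kern t b2 r2 n m)%:E))%E.
    apply: eq_esum => n _; rewrite -esumZl ?lee_fin ?kern_ge0 //.
      by apply: eq_esum => m _; rewrite muleA -EFinM muleC.
    by move=> m; rewrite mule_ge0 ?zpath_ge0 // lee_fin kern_ge0.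
  rewrite esum_exchange => [|n m].
    apply: eq_esum => m _; rewrite esumZl ?zpath_ge0 // => n.
    by rewrite lee_fin mulr_ge0 // kern_ge0.
  by rewrite mule_ge0 ?zpath_ge0 // lee_fin mulr_ge0 // kern_ge0.
rewrite !flat // -esumZl.
- apply: eq_esum => m _.
  have [/andP[cm1 cm2]|cm] := boolP (config m.1 && config m.2).
    by rewrite (@kern_cauchy _ x y) // muleCA.
  by rewrite !esum1 ?mule0 // => n _; rewrite (kern_out _ _ _ cm) mulr0.
- by rewrite lee_fin invr_ge0 mulr_ge0 // subr_ge0 ltW.
- move=> m; rewrite mule_ge0 ?zpath_ge0 // esum_ge0 // => n _.
  by rewrite lee_fin mulr_ge0 // kern_ge0.
Qed.

Lemma zpath_cons s w w' c a : 0 < s.2 -> positive_word w' -> 0 <= c ->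
  (forall a', config a'.1 && config a'.2 -> zpath w a' = (c%:E * zpath w' a')%E) ->
  (zpath (s :: w) a = c%:E * zpath (s :: w') a)%E.
Proof.
move=> s0 w0 c0 ww' /=; rewrite -esumZl //.
- apply: eq_esum => n _; have [cn|cn] := boolP (config n.1 && config n.2).
    by rewrite ww' // muleCA.
  by rewrite (kern_out _ _ _ cn) !mul0e mule0.
- by move=> n; rewrite mule_ge0 ?zpath_ge0 // lee_fin kern_ge0.
Qed.

Lemma zpath_move_particle (hs : seq R) y w a : all (fun x => 0 < x) hs -> 0 < y -> positive_word w ->
  (forall x, x \in hs -> x * y < 1 /\ x * y * t < 1) -> config a.1 && config a.2 ->
  (zpath ([seq (true, x) | x <- hs] ++ (false, y) :: w) a =
   (\prod_(x <- hs) cauchy_factor (x * y))%:E *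
     zpath ((false, y) :: [seq (true, x) | x <- hs] ++ w) a)%E.
Proof.
move=> + y0 w0; elim: hs a => [|x hs IH] a /=; first by rewrite big_nil mul1e.
move=> /andP[x0 hs0] hxy ca.
have pw : positive_word ([seq (true, x) | x <- hs] ++ w).
  by rewrite /positive_word all_cat all_map; apply/andP; split.
have hs1 i : i \in hs -> i * y < 1 /\ i * y * t < 1 by move=> ih; apply: hxy; rewrite inE ih orbT.
have [xy1 xyt1] := hxy x (mem_head _ _).
have c0 : 0 <= \prod_(j <- hs) cauchy_factor (j * y).
  rewrite big_seq; apply: prodr_ge0 => i /hs1[i1 i2].
  by rewrite invr_ge0 mulr_ge0 // subr_ge0 ltW.
rewrite -[LHS]/(zpath ((true, x) :: _) a).
rewrite (@zpath_cons _ _ ((false, y) :: [seq (true, x) | x <- hs] ++ w) _ _ _ _ c0) //=.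
- by rewrite -/(zpath ((true, x) :: (false, y) :: _) a) zpath_swap // muleA -EFinM big_cons mulrC.
- by rewrite y0.
- by move=> a' ca'; exact: IH.
Qed.

Lemma esum_delta (T : choiceType) (j : T) (f : T -> \bar R) : (0 <= f j)%E ->
  (\esum_(i in [set: T]) ((i == j)%:R%:E * f i) = f j)%E.
Proof.
move=> fj; rewrite -[RHS](@esum_set1 _ _ j f) // [RHS]esum_mkcond; apply: eq_esum => i _.
have [->|ij] := eqVneq i j; first by rewrite mul1e ifT // inE.
by rewrite mul0e ifF //; apply/negbTE; rewrite notin_setE /= => /eqP; exact/negP.
Qed.

Variables (q : R) (is_hole : nat -> bool).
Hypotheses (q0 : 0 < q) (q1 : q < 1) (qt1 : q * t < 1).

(* Hole slice [k] and particle slice [k'] have parameters with product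
   [q ^ (k' - k)], and the total exponent of [q] telescopes to the volume. *)
Definition slice_word m l : seq (bool * R) :=
  [seq (is_hole k, if is_hole k then q ^- k else q ^+ k) | k <- iota m l].

Lemma positive_slice_word m l : positive_word (slice_word m l).
Proof. by apply/allP => s /mapP[k _ ->] /=; case: ifP => _; rewrite ?invr_gt0 exprn_gt0. Qed.

(** Induction with the invariant that the holes before [m] wait in front and the particle steps
    before [m] are used up. A particle step moved to the front acts on a packed configuration and
    removes its top particle; [d] counts those to come. *)
Lemma zpath_sort m l : let d := count (predC is_hole) (iota m l) in
  (zpath ([seq (true, x) | x <- [seq q ^- k | k <- iota 0 m & is_hole k]] ++ slice_word m l)
         (iota 1 d, iota 1 d) =
  (\prod_(k' <- iota m l | ~~ is_hole k') \prod_(k <- iota 0 k' | is_hole k) cauchy_factor (q ^+ (k' - k)))%:E)%E.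
Proof.
have pos (s : seq nat) : all (fun x => 0 < x) [seq q ^- k | k <- s].
  by apply/allP => s' /mapP[k _ ->]; rewrite invr_gt0 exprn_gt0.
elim: l m => [|l IH] m /=.
  rewrite big_nil cats0; move: [seq _ | k <- _ & _] (pos [seq k <- iota 0 m | is_hole k]) => hs.
  elim: hs => [|x hs IH] //= /andP[x0 hs0].
  under eq_esum do rewrite kern_nil.
  by rewrite esum_delta ?IH // lee_fin.
have fS : [seq k <- iota 0 m.+1 | is_hole k] = [seq k <- iota 0 m | is_hole k] ++ [seq k <- [:: m] | is_hole k].
  by rewrite -filter_cat -[in LHS](addn1 m) iotaD.
have IHm := IH m.+1; rewrite fS /= in IHm; rewrite big_cons.
case: (boolP (is_hole m)) IHm => bm /=; rewrite ?map_cat ?cats0 /= => IHm.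
  by rewrite -IHm /slice_word /= bm -catA add0n.
have -> : slice_word m l.+1 = (false, q ^+ m) :: slice_word m.+1 l by rewrite /slice_word /= (negPf bm).
rewrite (@zpath_move_particle _ _ (slice_word m.+1 l)) ?config_iota //.
- rewrite zpath_consE; under eq_esum do rewrite kern_iota.
  rewrite esum_delta; last first.
    rewrite zpath_ge0 // /positive_word all_cat; apply/andP; split; last exact: positive_slice_word.
    by rewrite !all_map; apply/allP => k _ /=; rewrite invr_gt0 exprn_gt0.
  rewrite add0n in IHm *; rewrite IHm -EFinM big_map big_filter; congr (_ * _)%:E.
  rewrite big_seq_cond [RHS]big_seq_cond; apply: eq_bigr => k.
  rewrite mem_iota add0n /= => /andP[km _]; congr cauchy_factor.
  by rewrite -(subnK (ltnW km)) addnK exprD mulrC mulfK // gt_eqF // exprn_gt0.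
- exact: exprn_gt0.
- exact: positive_slice_word.
2: by apply/andP; split; exact: (config_iota _.+1).
move=> x /mapP[k]; rewrite mem_filter mem_iota add0n /= => /andP[_ km] ->.
(* Since [k < m] a factor [q] splits off, so [q < 1] and [q * t < 1] suffice even when [t > 1]. *)
have -> : q ^- k * q ^+ m = q * q ^+ (m - k).-1.
  rewrite -exprS prednK ?subn_gt0 // -[in LHS](subnK (ltnW km)) exprD mulrC mulfK //.
  by rewrite gt_eqF // exprn_gt0.
have e0 : 0 <= q ^+ (m - k).-1 by rewrite exprn_ge0 // ltW.
have e1 : q ^+ (m - k).-1 <= 1 by rewrite exprn_ile1 // ltW.
split; first by rewrite (le_lt_trans _ q1) // ler_piMr // ltW.
by rewrite mulrAC (le_lt_trans _ qt1) // ler_piMr // mulr_ge0 // ltW.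
Qed.
End Path.

(** * Paths of configurations and pairs of fillings *)

Section PathWeight.
Variables (R : realType) (t : R).
Hypothesis t0 : 0 < t.

Notation nil2 := (([::], [::]) : config2).

(** The summand of [zpath] along an explicit path; a wrong length has weight 0, so that the sum may
    run over all sequences. *)
Fixpoint pweight (w : seq (bool * R)) (a : config2) (p : seq config2) : R :=
  match w, p with
  | [::], [::] => (a == nil2)%:R
  | s :: w', n :: p' => kern t s.1 s.2 a n * pweight w' n p'
  | _, _ => 0
  end.

Lemma pweight_ge0 w a p : positive_word w -> 0 <= pweight w a p.
Proof.
elim: w a p => [|s w IH] a [|n p] //= /andP[s0 w0].
by rewrite mulr_ge0 ?kern_ge0 ?IH.
Qed.

Lemma zpath_pweight w a : positive_word w ->
  (zpath t w a = \esum_(p in [set: seq config2]) (pweight w a p)%:E)%E.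
Proof.
elim: w a => [|s w IH] a /=.
  move=> _; rewrite -[LHS](@esum_delta _ (seq config2) [::] (fun=> (a == nil2)%:R%:E)) ?lee_fin //.
  by apply: eq_esum => -[|n p] _; rewrite ?mul1e ?mul0e.
move=> /andP[s0 w0].
transitivity (\esum_(n in [set: config2]) \esum_(p in [set: seq config2])
    (kern t s.1 s.2 a n * pweight w n p)%:E)%E.
  apply: eq_esum => n _; rewrite IH // -esumZl ?lee_fin ?kern_ge0 // => p.
  by rewrite lee_fin pweight_ge0.
rewrite (@esum_esum _ _ _ _ (fun=> [set: seq config2]%classic)); last first.
  by move=> n p _ _; rewrite lee_fin mulr_ge0 ?kern_ge0 ?pweight_ge0.
have -> : ([set: config2] `*`` (fun=> [set: seq config2]) = [set: config2 * seq config2])%classic.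
  by apply/seteqP; split.
transitivity (\esum_(p in (fun k : config2 * seq config2 => k.1 :: k.2) @` setT)
   (pweight (s :: w) a p)%:E)%E.
  by rewrite esum_image // => -[n p] [n' p'] _ _ [-> ->].
rewrite esum_mkcond; apply: eq_esum => -[|n p] _; first by case: ifP.
by rewrite ifT // inE; exists (n, p).
Qed.

Lemma pweight_neq0 w a p : pweight w a p != 0 -> size p = size w /\
  forall k, (k < size w)%N ->
    kern t (nth (true, 0) w k).1 (nth (true, 0) w k).2 (nth nil2 (a :: p) k) (nth nil2 (a :: p) k.+1) != 0.
Proof.
elim: w a p => [|s w IH] a [|n p] //=; rewrite ?eqxx //.
rewrite mulf_eq0 negb_or => /andP[kn /IH[-> H]]; split=> // -[|k] //= kw.
exact: H.
Qed.

Variables (q : R) (la : seq nat).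
Hypotheses (q0 : 0 < q) (hla : is_partition la).
Let ell := size la.
Let n := nslices la.
Let w := slice_word q (is_hole la).

Lemma pweight_fun (a : nat -> config2) m l :
  pweight (w m l) (a m) [seq a k | k <- iota m.+1 l] =
  (\prod_(k <- iota m l) kern t (is_hole la k) (if is_hole la k then q ^- k else q ^+ k) (a k) (a k.+1))
  * (a (m + l)%N == nil2)%:R.
Proof.
elim: l m => [|l IH] m; first by rewrite big_nil mul1r addn0.
by rewrite /w /slice_word /= -/(slice_word _ _ _ _) IH big_cons mulrA addSnnS.
Qed.

Definition diag_path (x : filling la * filling la) : seq config2 :=
  [seq (diag x.1 k, diag x.2 k) | k <- iota 1 n].

Lemma diag0 (L : filling la) : diag L 0 = iota 1 ell.
Proof.
rewrite /diag diag_rows0 -[RHS]map_id; apply/eq_in_map => i; rewrite mem_iota add1n ltnS => /andP[_ il].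
by rewrite diag_entry0 // addn0.
Qed.

Lemma kern_rpp (L L' : filling la) k r : RPP la L -> RPP la L' ->
  kern t (is_hole la k) r (diag L k, diag L' k) (diag L k.+1, diag L' k.+1) =
  r ^+ (vol_exp (is_hole la k) (diag L k) (diag L k.+1) + vol_exp (is_hole la k) (diag L' k) (diag L' k.+1))
  * t ^+ slice_pairs L L' k.
Proof.
move=> rL rL'; rewrite /kern /= !config_diag // !ilace_diag // !size_diag -!(diag_rowsS hla) eqxx /=.
by rewrite coupled_exp_slice.
Qed.

(** Abel summation. With [D_k] the sum of diagonal [k], a hole slice raises it and a particle slice
    lowers it, so the parameters [q ^- k] and [q ^+ k] both yield the exponent [k (D_k - D_(k+1))].
    The extra factor is the boundary term, trivial at the empty last diagonal. *)
Lemma prod_volume (L L' : filling la) m : RPP la L -> RPP la L' ->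
  (\prod_(k <- iota 0 m) (if is_hole la k then q ^- k else q ^+ k) ^+
     (vol_exp (is_hole la k) (diag L k) (diag L k.+1) + vol_exp (is_hole la k) (diag L' k) (diag L' k.+1)))
  * q ^+ (m * (dsum L m + dsum L' m))
  = q ^+ (\sum_(0 <= k < m.+1) dsum L k + \sum_(0 <= k < m.+1) dsum L' k).
Proof.
move=> rL rL'; have qn0 : q != 0 by rewrite gt_eqF.
elim: m => [|m IH]; first by rewrite big_nil mul1r !big_nat1 !dsum0.
rewrite -[X in iota 0 X](addn1 m) iotaD add0n big_cat big_seq1 /=.
have sS (M : filling la) : (\sum_(0 <= k < m.+2) dsum M k =
    \sum_(0 <= k < m.+1) dsum M k + dsum M m.+1)%N by rewrite big_nat_recr.
rewrite !sS addnACA [RHS]exprD -IH.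
rewrite -!mulrA; congr (_ * _).
have := vol_exp_slice hla m rL; have := vol_exp_slice hla m rL'.
move: (vol_exp _ _ _) (vol_exp _ _ _) => v v'; case: (is_hole la m) => e1 e2.
  rewrite -e1 -e2 -exprVn -exprM -!exprD.
  have e : (m.+1 * (v + dsum L m + (v' + dsum L' m)) =
     m * (v + v') + (m * (dsum L m + dsum L' m) + (v + dsum L m + (v' + dsum L' m))))%N by lia.
  by rewrite e exprD exprVn mulKf // expf_neq0.
rewrite -exprM -!exprD -e1 -e2; congr (q ^+ _); lia.
Qed.

Lemma pweight_diag_path x : (RPP la `*` RPP la)%classic x ->
  pweight (w 0 n) (iota 1 ell, iota 1 ell) (diag_path x) =
  q ^+ (volume x.1 + volume x.2) * t ^+ coupled_pairs x.1 x.2.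
Proof.
case: x => L L' [/= rL rL'].
have := pweight_fun (fun k => (diag L k, diag L' k)) 0 n.
rewrite !diag0 /diag_path /= => ->.
rewrite /diag diag_rows_last // eqxx mulr1 -/(diag _ _).
under eq_bigr do rewrite kern_rpp //.
rewrite big_split /= prodrXr coupled_pairsE // /index_iota subn0; congr (_ * _).
by have := prod_volume n rL rL'; rewrite !dsum_last // muln0 mulr1 -!volumeE.
Qed.

Lemma diag_path_inj : {in (RPP la `*` RPP la)%classic &, injective diag_path}.
Proof.
have diag_inj (L L' : filling la) : (forall k, (k < n)%N -> diag L k.+1 = diag L' k.+1) -> L = L'.
  move=> e; apply/ffunP => c; rewrite -!entryE.
  have := valP c; case: (val c) => i j /=; rewrite (mem_cells hla) => /and3P[i0 j0 ji].
  have il : (i <= size la)%N by case: leqP => // /(part_out hla); lia.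
  have p1 := @part_mono la hla 1 i i0.
  pose k := (j + size la - i).-1.
  have kE : k.+1 = (j + size la - i)%N by rewrite /k; lia.
  have kn : (k < n)%N by rewrite kE /n /nslices; lia.
  have ir : (i.-1 < diag_rows la k.+1)%N.
    by rewrite prednK // (leq_diag_rows hla) // kE; have := particle_posE hla i0 il; lia.
  have := congr1 (fun s => nth 0%N s i.-1) (e k kn); rewrite !nth_diag // prednK // => /addIn.
  by rewrite /diag_entry (_ : (i + k.+1 - size la)%N = j) //; lia.
move=> [L1 L2] [M1 M2] _ _ e.
have ek k : (k < n)%N -> (diag L1 k.+1, diag L2 k.+1) = (diag M1 k.+1, diag M2 k.+1).
  move=> kn; have := congr1 (fun s => nth nil2 s k) e.
  by rewrite /diag_path !(nth_map 0%N) ?size_iota // !nth_iota.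
by congr pair; apply: diag_inj => k /ek[].
Qed.

Lemma diag_path_surj p : pweight (w 0 n) (iota 1 ell, iota 1 ell) p != 0 ->
  exists2 x, (RPP la `*` RPP la)%classic x & diag_path x = p.
Proof.
move=> /pweight_neq0[]; rewrite /w /slice_word size_map size_iota => sp H.
pose A k := nth nil2 ((iota 1 ell, iota 1 ell) :: p) k.
have HA k : (k < n)%N -> [/\ config (A k.+1).1, config (A k.+1).2, ilace (A k).1 (A k.+1).1,
   ilace (A k).2 (A k.+1).2 & size (A k).1 = (size (A k.+1).1 + ~~ is_hole la k)%N
   /\ size (A k).2 = (size (A k.+1).2 + ~~ is_hole la k)%N].
  move=> kn; have := H k kn; rewrite (nth_map 0%N) ?size_iota // nth_iota // add0n /=.
  rewrite -/(A k) -/(A k.+1) /kern; case: ifP => [|_]; last by rewrite eqxx.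
  by move=> /and5P[? ? ? ? /andP[/eqP ? /eqP ?]] _.
have [|||L rL eL] := @fill_exists la hla (fun k => (A k).1) erefl.
- by move=> k /HA[].
- by move=> k /HA[].
- by move=> k /HA[_ _ _ _ []].
have [|||L' rL' eL'] := @fill_exists la hla (fun k => (A k).2) erefl.
- by move=> k /HA[].
- by move=> k /HA[].
- by move=> k /HA[_ _ _ _ []].
exists (L, L') => //; apply: (@eq_from_nth _ nil2); rewrite size_map size_iota // => k kn.
rewrite (nth_map 0%N) ?size_iota // nth_iota // add1n /= eL // eL' //.
by rewrite -surjective_pairing.
Qed.

Lemma zpath_rpp :
  (zpath t (w 0 n) (iota 1 ell, iota 1 ell) =
   \esum_(x in RPP la `*` RPP la)
     (q ^+ (volume x.1 + volume x.2) * t ^+ coupled_pairs x.1 x.2)%:E)%E.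
Proof.
rewrite zpath_pweight; last exact: positive_slice_word.
transitivity (\esum_(p in diag_path @` (RPP la `*` RPP la))
    (pweight (w 0 n) (iota 1 ell, iota 1 ell) p)%:E)%E.
  rewrite [RHS]esum_mkcond; apply: eq_esum => p _; case: ifPn => // pn.
  congr EFin; apply/eqP; apply: contraNT pn => /diag_path_surj[x xr <-].
  by rewrite inE; exists x.
rewrite esum_image; last exact: diag_path_inj.
by apply: eq_esum => x xr; rewrite pweight_diag_path.
Qed.
End PathWeight.

(** * From real parameters to formal power series *)

Section PowerSeries.
Variable R : realType.

Definition psum (a : nat -> R) (q : R) (N : nat) : R := \sum_(0 <= n < N) a n * q ^+ n.

Definition evals (a : nat -> R) (q V : R) : Prop :=
  forall e, 0 < e -> exists N0, forall N, (N0 <= N)%N -> `|psum a q N - V| < e.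

(** Denominators are cleared before the comparison, so only binomials are multiplied in; a partial
    sum of the product combines two partial sums of [f]. *)
Lemma evals_mul (f : fps R) (h : nat) (s q V : R) :
  evals (fps_coef f) q V ->
  evals (fps_coef (f * (1 - fpsX R ^+ h * fpsC s))) q ((1 - s * q ^+ h) * V).
Proof.
move=> fV.
have cE n : fps_coef (f * (1 - fpsX R ^+ h * fpsC s)) n =
    fps_coef f n - (if (h <= n)%N then fps_coef f (n - h) * s else 0).
  rewrite mulrBr mulr1 -[LHS]/(fps_coef f n - \sum_(k < n.+1) fps_coef f k *
    fps_coef (fpsX R ^+ h * fpsC s) (n - k)); congr (_ - _).
  under eq_bigr do rewrite coef_fpsXnC.
  case: leqP => [hn|nh]; last by rewrite big1 // => k _; case: eqP => [e|]; [lia|rewrite mulr0].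
  have kn : (n - h < n.+1)%N by lia.
  rewrite (bigD1 (Ordinal kn)) //= subKn // eqxx big1 ?addr0 // => k /eqP nk.
  case: eqP => [e|]; last by rewrite mulr0.
  by case: nk; apply: val_inj => /=; have := ltn_ord k; lia.
have sE N : psum (fps_coef (f * (1 - fpsX R ^+ h * fpsC s))) q (h + N) =
    psum (fps_coef f) q (h + N) - s * q ^+ h * psum (fps_coef f) q N.
  rewrite {1}/psum; under eq_bigr do rewrite cE mulrBl.
  rewrite sumrB; congr (_ - _).
  rewrite (big_cat_nat (leq0n h) (leq_addr N h)) /= big_nat big1 ?add0r => [|n /andP[_ nh]]; last first.
    by rewrite leqNgt nh mul0r.
  rewrite -{1}[h]add0n big_addn addKn /psum mulr_sumr; apply: eq_bigr => n _.
  by rewrite leq_addl addnK exprD; ring.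
move=> e e0.
have [N0 H0] := fV (e / 2) ltac:(lra).
have c0 : 0 < 2 * (1 + `|s * q ^+ h|) by have := normr_ge0 (s * q ^+ h); lra.
have [N1 H1] := fV (e / (2 * (1 + `|s * q ^+ h|))) (divr_gt0 e0 c0).
exists (h + (N0 + N1))%N => N NN; have hN : (h <= N)%N by lia.
rewrite -(subnKC hN) sE; set M := (N - h)%N; set c := s * q ^+ h in c0 H1 *.
have -> : psum (fps_coef f) q (h + M) - c * psum (fps_coef f) q M - (1 - c) * V =
   (psum (fps_coef f) q (h + M) - V) - c * (psum (fps_coef f) q M - V) by ring.
apply: le_lt_trans (ler_normB _ _) _; rewrite normrM.
have h0 := H0 (h + M)%N ltac:(rewrite /M; lia); have h1 := H1 M ltac:(rewrite /M; lia).
have : `|c| * `|psum (fps_coef f) q M - V| <= e / 2.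
  rewrite ltr_pdivlMr // in h1; have := normr_ge0 c; have := normr_ge0 (psum (fps_coef f) q M - V).
  by move: h1; set u := `|_ - _|; set v := `|c| => h1 u0 v0; nra.
lra.
Qed.

Lemma geometric_tail (r : R) M N : 0 <= r <= 2^-1 -> (M <= N)%N ->
  \sum_(M <= n < N) r ^+ n <= 2 * r ^+ M - 2 * r ^+ N.
Proof.
move=> /andP[r0 r1] MN; rewrite -(subnKC MN); elim: (N - M)%N => [|k IH].
  by rewrite addn0 big_geq // subrr.
rewrite addnS big_nat_recr ?leq_addr //= exprS.
have : 0 <= r ^+ (M + k) by rewrite exprn_ge0.
by move: IH; set u := r ^+ (M + k); nra.
Qed.

(* Identity theorem: near 0 the lowest nonzero term dominates. *)
Lemma evals_eq0 (d : nat -> R) (r : R) : 0 < r ->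
  (forall q, 0 < q < r -> evals d q 0) -> forall m, d m = 0.
Proof.
move=> r0 H; pose q1 := r / 2; have q10 : 0 < q1 by rewrite /q1; lra.
have [C C0 HC] : exists2 C, 0 < C & forall n, `|d n| * q1 ^+ n <= C.
  have [N0 HN] := H q1 ltac:(rewrite /q1; lra) 1 ltr01.
  (* From [N0] on, two consecutive partial sums of size below 1 bound a term by 2; the sum covers
     the earlier terms. *)
  exists (2 + \sum_(0 <= k < N0) `|d k| * q1 ^+ k).
    by rewrite ltr_pwDl // sumr_ge0 // => k _; rewrite mulr_ge0 // exprn_ge0 // ltW.
  move=> n; have [nN|Nn] := ltnP n N0.
    rewrite big_mkord (bigD1 (Ordinal nN)) //= addrCA lerDl addr_ge0 //.
    by rewrite sumr_ge0 // => k _; rewrite mulr_ge0 // exprn_ge0 // ltW.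
  apply: (@le_trans _ _ 2); last first.
    by rewrite lerDl sumr_ge0 // => k _; rewrite mulr_ge0 // exprn_ge0 // ltW.
  have := HN n Nn; have := HN n.+1 (leqW Nn); rewrite !subr0 {1}/psum big_nat_recr //= -/(psum d q1 n).
  have -> : `|d n| * q1 ^+ n = `|d n * q1 ^+ n| by rewrite normrM normrX (gtr0_norm q10).
  move: (psum d q1 n) (d n * q1 ^+ n) => u v h1 h2.
  have := ler_normB (u + v) u; rewrite addrC addKr; lra.
elim/ltn_ind=> m IH; apply/eqP/negPn/negP => dm.
pose D := `|d m| * q1 ^+ m.
have D0 : 0 < D by rewrite mulr_gt0 ?normr_gt0 // exprn_gt0.
(* With [rho <= 1/2] the tail is at most [2 C rho^(m+1)], and the partial sum is below
   [C rho^(m+1)]. Hence [D < 3 C rho], against [4 C rho <= D]. *)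
pose rho := Num.min 2^-1 (D / (4 * C)).
have rho0 : 0 < rho by rewrite lt_min; apply/andP; split; [lra|rewrite divr_gt0 // mulr_gt0].
have rho1 : rho <= 2^-1 by rewrite ge_min lexx.
have rho2 : 4 * C * rho <= D.
  have : rho <= D / (4 * C) by rewrite ge_min lexx orbT.
  by rewrite ler_pdivlMr ?mulr_gt0 // mulrC.
pose q := q1 * rho.
have qr : 0 < q < r by rewrite mulr_gt0 //= /q /q1; nra.
have pm : 0 < rho ^+ m by rewrite exprn_gt0.
have eps0 : 0 < C * rho ^+ m.+1 by rewrite mulr_gt0 // exprn_gt0.
have [N0 HN] := H q qr _ eps0.
have := HN (m.+1 + N0)%N (leq_addl _ _); rewrite subr0 /psum.
rewrite (big_cat_nat (leq0n m) (leq_trans (leqnSn m) (leq_addr N0 m.+1))) /=.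
rewrite big_nat big1 ?add0r => [|k /andP[_ km]]; last by rewrite IH // mul0r.
rewrite big_ltn ?leq_addr //; set T := \sum_(_ <= _ < _) _.
have TE : `|T| <= 2 * C * rho ^+ m.+1.
  apply: (@le_trans _ _ (\sum_(m.+1 <= k < m.+1 + N0) C * rho ^+ k)).
    apply: le_trans (ler_norm_sum _ _ _) _; apply: ler_sum => k _.
    by rewrite /q exprMn mulrA normrM normrM normrX (gtr0_norm q10) (gtr0_norm (exprn_gt0 _ rho0)) ler_wpM2r // exprn_ge0 // ltW.
  rewrite -mulr_sumr -mulrA mulrCA ler_pM2l //.
  apply: le_trans (geometric_tail _ (leq_addr _ _)) _; first by rewrite rho1 ltW.
  by rewrite gerBl mulr_ge0 // exprn_ge0 // ltW.
have dE : `|d m * q ^+ m| = D * rho ^+ m.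
  by rewrite /q exprMn mulrA normrM normrM normrX (gtr0_norm q10) (gtr0_norm pm).
move=> h; have h2 : D * rho ^+ m <= `|d m * q ^+ m + T| + `|T|.
  by rewrite -dE; have := ler_normB (d m * q ^+ m + T) T; rewrite addrK.
have : D * rho ^+ m < 3 * C * rho * rho ^+ m by rewrite exprS in h TE; lra.
rewrite ltr_pM2r // => h3; nra.
Qed.
End PowerSeries.

Lemma esum_evals (R : realType) (a : nat -> R) (q V : R) : 0 <= q -> (forall n, 0 <= a n) ->
  (\esum_(n in [set: nat]) (a n * q ^+ n)%:E = V%:E)%E -> evals a q V.
Proof.
move=> q0 a0 eV e e0.
have t0 n : 0 <= a n * q ^+ n by rewrite mulr_ge0 // exprn_ge0.
have up N : psum a q N <= V.
  rewrite -lee_fin -eV /psum -sumEFin; apply: esum_ge.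
  exists [set` index_iota 0 N]%classic; first by split => //; exact: finite_seq.
  by rewrite -fsbig_seq // iota_uniq.
have : ((V - e)%:E < \esum_(n in [set: nat]) (a n * q ^+ n)%:E)%E by rewrite eV lte_fin; lra.
move=> /ereal_sup_gt[_ [X [finX _]] <-]; rewrite fsbig_finite //= => hX.
have [N0 XN0] : exists N0, forall n, n \in fset_set X -> (n < N0)%N.
  exists (\max_(n <- fset_set X) n).+1 => n nX.
  by rewrite ltnS; exact: leq_bigmax_seq.
exists N0 => N NN.
have : V - e < psum a q N.
  rewrite -lte_fin; apply: lt_le_trans hX _; rewrite /psum -sumEFin.
  apply: (@lee_sum_fset_nat _ _ _ _ predT) => [n _|n /= /XN0 nN]; first by rewrite lee_fin.
  exact: leq_trans nN NN.
by have := up N; move: (psum a q N) => s; rewrite ltr_norml; lra.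
Qed.

(** * Comparison of the two series *)

Section Main.
Variables (R : realType) (t : R) (la : seq nat).
Hypotheses (t0 : 0 < t) (hla : is_partition la).

Let P := (RPP la `*` RPP la)%classic.
Let term (x : filling la * filling la) : fps R :=
  fpsX R ^+ (volume x.1 + volume x.2) * fpsC (t ^+ coupled_pairs x.1 x.2).
Let F := fps_sum P term.

Let termE x n : fps_coef (term x) n =
  if n == (volume x.1 + volume x.2)%N then t ^+ coupled_pairs x.1 x.2 else 0.
Proof. exact: coef_fpsXnC. Qed.

Let term_ge0 x n : 0 <= fps_coef (term x) n.
Proof. by rewrite termE; case: ifP => // _; rewrite exprn_ge0 // ltW. Qed.

Let coef_esum n :
  (\esum_(x in P) (fps_coef (term x) n)%:E = (fps_coef F n)%:E)%E.
Proof.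
pose J := (P `&` [set x | fps_coef (term x) n != 0])%classic.
have finJ : finite_set J by apply: finite_setIr; exact: rpp_pairs_summable.
transitivity (\esum_(x in J) (fps_coef (term x) n)%:E)%E.
  rewrite /J [RHS]esum_mkcondr; apply: eq_esum => x _; case: ifPn => //.
  by rewrite notin_setE /= => /negP/negPn/eqP ->.
rewrite esum_fset // => [|x _]; last by rewrite lee_fin.
rewrite fsumEFin //; congr EFin; apply: fsbig_widen; first exact: subIsetl.
by move=> x [Px Jx]; apply/eqP/negPn/negP => h; apply: Jx; split.
Qed.

Let F_ge0 n : 0 <= fps_coef F n.
Proof. by rewrite -lee_fin -coef_esum; apply: esum_ge0 => x _; rewrite lee_fin. Qed.

(** The path sum is computed twice: as the sorted product, and as a sum over pairs of fillings,
    regrouped by total volume. *)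
Lemma evals_rpp q : 0 < q < 1 -> q * t < 1 ->
  evals (fps_coef F) q (\prod_(c : cell la) cauchy_factor t (q ^+ hook la (val c))).
Proof.
move=> /andP[q0 q1] qt1; apply: esum_evals => //; first exact: ltW.
rewrite -(prod_slices hla (fun h => cauchy_factor t (q ^+ h))).
have := @zpath_sort R t t0 q (is_hole la) q0 q1 qt1 0 (nslices la).
rewrite /= count_particles // => <-; rewrite zpath_rpp //.
transitivity (\esum_(n in [set: nat]) \esum_(x in P) (fps_coef (term x) n * q ^+ n)%:E)%E.
  apply: eq_esum => n _; rewrite EFinM -coef_esum muleC -esumZl.
  - by apply: eq_esum => x _; rewrite muleC EFinM.
  - by rewrite lee_fin exprn_ge0 // ltW.
  - by move=> x; rewrite lee_fin.
under eq_esum do rewrite esum_mkcond.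
rewrite esum_exchange; last first.
  by move=> n x; case: ifP => // _; rewrite lee_fin mulr_ge0 // exprn_ge0 // ltW.
rewrite [RHS]esum_mkcond; apply: eq_esum => x _; case: ifPn => [_|_]; last by rewrite esum1.
rewrite -[RHS](@esum_delta _ _ (volume x.1 + volume x.2)%N (fun n => (q ^+ n * t ^+ coupled_pairs x.1 x.2)%:E)).
  apply: eq_esum => n _; rewrite termE; case: eqP => [_|_]; last by rewrite mul0r mul0e.
  by rewrite mul1e mulrC.
by rewrite lee_fin mulr_ge0 // exprn_ge0 // ltW.
Qed.

Let hook_factor h : fps R := (1 - fpsX R ^+ h) * (1 - fpsX R ^+ h * fpsC t).

Let hook_factor_unit h : (0 < h)%N -> hook_factor h \is a GRing.unit.
Proof.
move=> h0; rewrite unfold_in /= /fps_unit /= big_ord1 /=.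
have -> : fps_coef (fpsX R ^+ h) 0 = 0 by rewrite coef_fpsXn; case: h h0.
by rewrite big_ord1 /= coef_fpsXn; case: h h0 => //= h _; rewrite mul0r !subr0 mulr1 oner_neq0.
Qed.

Let evals_hook_factor (f : fps R) q V h : evals (fps_coef f) q V ->
  evals (fps_coef (f * hook_factor h)) q ((1 - q ^+ h) * (1 - q ^+ h * t) * V).
Proof.
move=> fV; have := evals_mul h t (evals_mul h 1 fV).
have -> : fpsC (1 : R) = 1 by [].
rewrite (mulr1 (fpsX R ^+ h)) mul1r -mulrA -/(hook_factor h).
by have -> : (1 - t * q ^+ h) * ((1 - q ^+ h) * V) = (1 - q ^+ h) * (1 - q ^+ h * t) * V by ring.
Qed.

(** After multiplication by the invertible [G] it remains to see that [F * G - 1] evaluates to 0 at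
    all small [q], where the identity theorem applies. *)
Lemma rpp_identity : F = \prod_(c : cell la) (hook_factor (hook la (val c)))^-1.
Proof.
have hook0 (c : cell la) : (0 < hook la (val c))%N by rewrite /hook addn1.
pose G := \prod_(c : cell la) hook_factor (hook la (val c)).
have GV : G * \prod_(c : cell la) (hook_factor (hook la (val c)))^-1 = 1.
  by rewrite -big_split big1 //= => c _; rewrite divrr //; exact/hook_factor_unit/hook0.
suff FG : F * G = 1.
  by have := congr1 ( *%R F) GV; rewrite mulrA FG mul1r mulr1.
(* Below [r] both [q < 1] and [q * t < 1] hold, so by positivity of hooks no denominator
   vanishes. *)
pose r : R := Num.min 1 t^-1.
have r0 : 0 < r by rewrite lt_min ltr01 invr_gt0.
suff H : forall q, 0 < q < r -> evals (fps_coef (F * G - 1)) q 0.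
  apply/eqP; rewrite -subr_eq0; apply/eqP; apply: fpsP => n.
  exact: evals_eq0 r0 H n.
have cR (f a b : fps R) : f * (a * b) = f * b * a by rewrite mulrA mulrAC.
move=> q /andP[q0]; rewrite lt_min => /andP[q1 qt].
have qt1 : q * t < 1 by rewrite -ltr_pdivlMr // mul1r.
have key (s : seq (cell la)) : evals (fps_coef (F * \prod_(c <- s) hook_factor (hook la (val c)))) q
    (\prod_(c <- s) ((1 - q ^+ hook la (val c)) * (1 - q ^+ hook la (val c) * t)) *
     \prod_(c : cell la) cauchy_factor t (q ^+ hook la (val c))).
  elim: s => [|c s IH]; first by rewrite !big_nil mulr1 mul1r; apply: evals_rpp; rewrite ?q0.
  move: (evals_hook_factor (hook la (val c)) IH); rewrite !big_cons.
  by rewrite [in X in _ -> X](cR F) !mulrA.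
have := key (index_enum (cell la)); rewrite -/G -big_split big1 => [ev|c _]; last first.
  rewrite /cauchy_factor; have [m hm] : exists m, hook la (val c) = m.+1 by exists (hook la (val c)).-1; rewrite prednK.
  have e0 : 0 <= q ^+ m by rewrite exprn_ge0 // ltW.
  have e1 : q ^+ m <= 1 by rewrite exprn_ile1 // ltW.
  have a1 : q * q ^+ m < 1 by rewrite (le_lt_trans _ q1) // ler_piMr // ltW.
  have a2 : q * q ^+ m * t < 1.
    by rewrite mulrAC (le_lt_trans _ qt1) // ler_piMr // mulr_ge0 // ltW.
  by rewrite hm exprS /= divff // mulf_neq0 // subr_eq0 eq_sym lt_eqF.
move=> e e0; have [N0 HN] := ev e e0; exists N0.+1 => N NN.
have := HN N (ltnW NN); congr (`|_| < _); rewrite subr0 /psum.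
case: N NN => // N _; rewrite !big_nat_recl // -addrA [_ - 1]addrC addrA; congr (_ + _).
  by rewrite -[fps_coef (F * G - 1) 0]/(fps_coef (F * G) 0 - 1) expr0; ring.
by apply: eq_bigr => n _; rewrite -[fps_coef (F * G - 1) n.+1]/(fps_coef (F * G) n.+1 - 0) subr0.
Qed.
End Main.

Theorem mainTheorem1 (R : realType) (t : R) (ht : 0 < t)
    (la : seq nat) (hla : is_partition la) :
  fps_sum (RPP la `*` RPP la)%classic
    (fun p => fpsX R ^+ (volume p.1 + volume p.2)
              * fpsC (t ^+ coupled_pairs p.1 p.2))
  = \prod_(c : cell la)
      ((1 - fpsX R ^+ hook la (val c))
       * (1 - fpsX R ^+ hook la (val c) * fpsC t))^-1.
Proof. exact: rpp_identity. Qed.
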